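(* Let $N\ge2$ and let $f,g$ be two positive functions on $\mathbb{R}^N$ with $g$ locally integrable and $f$ lower semi-continuous. Assume that $$f(x)\le c_1|x|^{-\alpha}\quad\text{and}\quad g(x)\ge c_2|x|^{-\beta}\qquad\text{for }|x|\ge R_1,$$ where $\alpha,\beta,R_1,c_1,c_2$ are positive numbers and $$\beta\le N\quad\text{and}\quad\alpha>\frac{N-1}{N}\,\beta.$$ Then the isoperimetric problem $$\inf\Big\{P_f(M):\ M\text{ has locally finite perimeter and }|M|_g=d\Big\}\qquad(d>0)$$ has no solution, i.e. for every $d>0$ the infimum is not attained.
   Context: For measurable $M\subset\mathbb{R}^N$, $|M|_g=\int_M g(x)\,dx$ and $P_f(M)=\int_{\partial M}f(x)\,\mathcal{H}_{N-1}(dx)$, where $\partial M$ is the essential boundary of $M$ and $\mathcal{H}_{N-1}$ is $(N-1)$-dimensional Hausdorff measure. *)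

(* Defs.v *)
From HB Require Import structures.
From mathcomp Require Import all_boot all_order all_algebra.
From mathcomp Require Import all_classical all_reals all_analysis.

Set Implicit Arguments.
Unset Strict Implicit.
Unset Printing Implicit Defensive.

Import Order.TTheory GRing.Theory Num.Theory.
Import numFieldNormedType.Exports.

Local Open Scope classical_set_scope.
Local Open Scope ring_scope.

(* Outer measure obtained by covering with at most countably many members of  *)
(* the family E, weighted by w. An index None contributes nothing, so that    *)
(* finite (and empty) covers are allowed.                                     *)
Section cover_outer.
Local Open Scope ereal_scope.
Context {R : realType} {T I : Type} (E : I -> set T) (w : I -> \bar R).

Definition covers (X : set T) : set (nat -> option I) :=
  [set F | X `<=` \bigcup_k oapp E set0 (F k)].

Definition cover_outer (X : set T) : \bar R :=
  ereal_inf [set \sum_(k <oo) oapp w 0 (F k) | F in covers X].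

Hypothesis w_ge0 : forall i, 0 <= w i.

Let ow_ge0 i : 0 <= oapp w 0 i.
Proof. by case: i => [i|] //=. Qed.

Lemma cover_outer_ge0 X : 0 <= cover_outer X.
Proof. by apply: le_ereal_inf_tmp => _ [F _ <-]; exact: nneseries_ge0. Qed.

Lemma cover_outer0 : cover_outer set0 = 0.
Proof.
apply/eqP; rewrite eq_le cover_outer_ge0 andbT.
apply: ereal_inf_lbound; exists (fun=> None); first by [].
by rewrite eseries0.
Qed.

Lemma le_cover_outer : {homo cover_outer : A B / A `<=` B >-> A <= B}.
Proof.
move=> A B AB; apply/ereal_inf_le_tmp => _ [F BF <-].
by exists F => //; apply: subset_trans BF.
Qed.

Lemma cover_outer_sigma_subadditive : sigma_subadditive cover_outer.
Proof.
move=> A; have [[i ioo]|] := pselect (exists i, cover_outer (A i) = +oo).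
  rewrite (eseries_pinfty _ _ ioo) ?leey// => n _.
  by rewrite -ltNye (lt_le_trans _ (cover_outer_ge0 _)).
rewrite -forallNE => Aoo.
suff add2e (e : {posnum R}) : cover_outer (\bigcup_n A n) <=
    \sum_(i <oo) cover_outer (A i) + e%:num%:E.
  by apply/lee_addgt0Pr => _/posnumP[].
rewrite (le_trans _ (epsilon_trick _ _ _))//; last first.
  by move=> n; exact: cover_outer_ge0.
pose P n (B : nat -> option I) := covers (A n) B /\
  \sum_(k <oo) oapp w 0 (B k) <=
    cover_outer (A n) + (e%:num / (2 ^ n.+1)%:R)%:E.
have [G PG] : {G : nat -> nat -> option I & forall n, P n (G n)}.
  apply: (@choice _ _ P) => n; rewrite /P /cover_outer.
  set S := (X in ereal_inf X); move infS : (ereal_inf S) => iS.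
  case: iS infS => [r Sr|Soo|Soo].
  - have en1 : (0 < e%:num / (2 ^ n.+1)%:R)%R by [].
    have /(lb_ereal_inf_adherent en1) : ereal_inf S \is a fin_num by rewrite Sr.
    by move=> [_ [B AnB <-] xS]; exists B; split => //; rewrite -Sr; exact/ltW.
  - by have := Aoo n; rewrite /cover_outer Soo.
  - by have := cover_outer_ge0 (A n); rewrite /cover_outer Soo.
pose W (p : nat * nat) := oapp w 0 (G p.1 p.2).
have W_ge0 x : 0 <= W x by exact: ow_ge0.
apply: (@le_trans _ _ (\esum_(i in setT) W i)).
  have /card_esym/ppcard_eqP[f] := card_nat2.
  apply: ereal_inf_lbound => /=; exists (fun k => G (f k).1 (f k).2).
    move=> t [i _ /(PG i).1[j _ Bijt]]; exists (f^-1%FUN (i, j)) => //=.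
    by rewrite invK ?inE.
  rewrite -[in RHS](image_eq f) -[LHS]/(\sum_(k <oo) W (f k)).
  by rewrite -(esum_pred_image W _ xpredT) ?[fun=> _]set_true.
rewrite (_ : esum _ _ = \sum_(i <oo) \sum_(j <oo ) W (i, j)); last first.
  pose J : nat -> set (nat * nat) := fun i => [set (i, j) | j in setT].
  rewrite (_ : setT = \bigcup_k J k); last first.
    by rewrite predeqE => -[a b]; split => // _; exists a => //; exists b.
  rewrite esum_bigcupT //=; last first.
    apply/trivIsetP => i j _ _ ij.
    rewrite predeqE => -[n m] /=; split => //= -[] [_] _ [<-{n} _].
    by move=> [m' _] [] /esym/eqP; rewrite (negbTE ij).
  rewrite -(image_id [set: nat]) -fun_true esum_pred_image//; last first.
    by move=> n _; exact: esum_ge0.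
  apply: eq_eseriesr => /= j _.
  rewrite -(esum_pred_image W (pair j) predT)//=; last first.
    by move=> ? ? _ _; exact: (@can_inj _ _ _ snd).
  by congr esum; rewrite predeqE => -[a b]; split; move=> [i _ <-]; exists i.
by apply: lee_nneseries => [i _ _|i _]; [exact: nneseries_ge0|exact: (PG i).2].
Qed.

End cover_outer.

Section lebesgue.
Local Open Scope ereal_scope.
Context {R : realType}.

Definition box n (ab : 'rV[R]_n * 'rV[R]_n) : set 'rV[R]_n :=
  [set x | forall i, (ab.1 ord0 i < x ord0 i <= ab.2 ord0 i)%R].

Definition box_vol n (ab : 'rV[R]_n * 'rV[R]_n) : \bar R :=
  (\prod_(i < n) Num.max 0 (ab.2 ord0 i - ab.1 ord0 i))%R%:E.

Definition leb_outer n : set 'rV[R]_n -> \bar R := cover_outer (@box n) (@box_vol n).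

Lemma box_vol_ge0 n (ab : 'rV[R]_n * 'rV[R]_n) : 0 <= box_vol ab.
Proof. by rewrite lee_fin prodr_ge0 // => i _; rewrite le_max lexx. Qed.

HB.instance Definition _ n := isOuterMeasure.Build R 'rV[R]_n (@leb_outer n)
  (cover_outer0 _ (@box_vol_ge0 n)) (cover_outer_ge0 _ (@box_vol_ge0 n))
  (@le_cover_outer _ _ _ _ _)
  (cover_outer_sigma_subadditive _ (@box_vol_ge0 n)).

(* Lebesgue measure on the sigma-algebra of Lebesgue measurable subsets of    *)
(* R^n (those satisfying the Caratheodory condition for leb_outer).           *)
Definition leb n : {measure set (caratheodory_type (@leb_outer n)) -> \bar R} :=
  OuterMeasure.sort (@leb_outer n : {outer_measure set 'rV[R]_n -> \bar R}).

End lebesgue.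

Section euclidean.
Context {R : realType}.

(* The library norm on 'rV[R]_n is the sup norm. *)
Definition enorm n (x : 'rV[R]_n) : R := Num.sqrt (\sum_(i < n) x ord0 i ^+ 2).

Definition eball n (x : 'rV[R]_n) (r : R) : set 'rV[R]_n :=
  [set y | enorm (y - x) < r].

Definition ediam n (A : set 'rV[R]_n) : \bar R :=
  ereal_sup [set (enorm (p.1 - p.2))%:E | p in A `*` A].

Lemma ediam_ge0 n (A : set 'rV[R]_n) : A !=set0 -> (0 <= ediam A)%E.
Proof.
move=> [a Aa]; apply: (@le_trans _ _ (enorm (a - a))%:E).
  by rewrite lee_fin sqrtr_ge0.
by apply: ereal_sup_ubound; exists (a, a).
Qed.

End euclidean.

(* Hausdorff measure of integer dimension k in R^n, normalized by the volume  *)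
(* of the k-dimensional Euclidean unit ball.                                  *)
Section hausdorff.
Local Open Scope ereal_scope.
Context {R : realType}.

Definition unit_ball_vol k : R := fine (leb k (eball (0 : 'rV[R]_k) 1)).

Definition small_set n (delta : R) :=
  {A : set 'rV[R]_n | A !=set0 /\ ediam A <= delta%:E}.

Definition hausdorff_weight k n (delta : R) (A : small_set n delta) : \bar R :=
  (unit_ball_vol k * (fine (ediam (sval A)) / 2) ^+ k)%R%:E.

Definition hausdorff_pre k n (delta : R) : set 'rV[R]_n -> \bar R :=
  cover_outer (fun A : small_set n delta => sval A)
    (@hausdorff_weight k n delta).

Definition hausdorff_outer k n (X : set 'rV[R]_n) : \bar R :=
  ereal_sup [set hausdorff_pre k delta X | delta in [set delta | (0 < delta)%R]].

Lemma hausdorff_weight_ge0 k n delta (A : small_set n delta) :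
  0 <= hausdorff_weight k A.
Proof.
rewrite lee_fin mulr_ge0 ?exprn_ge0 ?divr_ge0 ?fine_ge0 ?measure_ge0//.
by apply: ediam_ge0; exact: (svalP A).1.
Qed.

Lemma hausdorff_outer_ge0 k n (X : set 'rV[R]_n) : 0 <= hausdorff_outer k X.
Proof.
apply: (@le_trans _ _ (hausdorff_pre k 1 X)).
  exact/cover_outer_ge0/hausdorff_weight_ge0.
by apply: ereal_sup_ubound; exists 1%R => //=.
Qed.

Lemma hausdorff_outer0 k n : hausdorff_outer k (set0 : set 'rV[R]_n) = 0.
Proof.
apply/eqP; rewrite eq_le hausdorff_outer_ge0 andbT.
apply: ge_ereal_sup => _ [delta _ <-].
by rewrite /hausdorff_pre cover_outer0//; exact: hausdorff_weight_ge0.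
Qed.

Lemma le_hausdorff_outer k n :
  {homo @hausdorff_outer k n : A B / A `<=` B >-> A <= B}.
Proof.
move=> A B AB; apply: ge_ereal_sup => _ [delta delta0 <-].
apply: (le_trans (le_cover_outer _ _ AB)).
by apply: ereal_sup_ubound; exists delta.
Qed.

Lemma hausdorff_outer_sigma_subadditive k n :
  sigma_subadditive (@hausdorff_outer k n).
Proof.
move=> F; apply: ge_ereal_sup => _ [delta delta0 <-].
apply: (le_trans (cover_outer_sigma_subadditive _
  (@hausdorff_weight_ge0 k n delta) F)).
apply: lee_nneseries => [i _ _|i _].
  exact/cover_outer_ge0/hausdorff_weight_ge0.
by apply: ereal_sup_ubound; exists delta.
Qed.

HB.instance Definition _ k n :=
  isOuterMeasure.Build R 'rV[R]_n (@hausdorff_outer k n)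
    (@hausdorff_outer0 k n) (@hausdorff_outer_ge0 k n)
    (@le_hausdorff_outer k n) (@hausdorff_outer_sigma_subadditive k n).

Definition hausdorff k n :
  {measure set (caratheodory_type (@hausdorff_outer k n)) -> \bar R} :=
  OuterMeasure.sort
    (@hausdorff_outer k n : {outer_measure set 'rV[R]_n -> \bar R}).

End hausdorff.

Section perimeter.
Local Open Scope ereal_scope.
Context {R : realType} (N : nat).
Implicit Types (M : set 'rV[R]_N) (f g : 'rV[R]_N -> R).

Definition leb_measurable M :=
  measurable (M : set (caratheodory_type (@leb_outer R N))).

Definition locally_integrable_rV g :=
  forall K : set 'rV[R]_N, compact K ->
    (leb N).-integrable (K : set (caratheodory_type (@leb_outer R N)))
      (EFin \o g).

(* Lebesgue density with respect to Euclidean balls; the essential boundary   *)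
(* consists of the points where M has neither density 0 nor density 1.        *)
Definition has_density M (x : 'rV[R]_N) (t : R) :=
  (fine (leb N (M `&` eball x r)) / fine (leb N (eball x r)))%R
    @[r --> (0 : R)^'+] --> t.

Definition essential_boundary M : set 'rV[R]_N :=
  [set x | ~ has_density M x 0%R /\ ~ has_density M x 1%R].

(* C^1 vector fields with compact support in Omega and |phi| <= 1.            *)
Definition test_field (Omega : set 'rV[R]_N) (phi : 'rV[R]_N -> 'rV[R]_N) :=
  [/\ forall x, differentiable phi x, continuous (jacobian phi),
      compact (closure [set x | phi x != 0%R]),
      closure [set x | phi x != 0%R] `<=` Omega &
      forall x, (enorm (phi x) <= 1)%R].

Definition divergence (phi : 'rV[R]_N -> 'rV[R]_N) x : R := \tr (jacobian phi x).

Definition perimeter_in (Omega M : set 'rV[R]_N) : \bar R :=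
  ereal_sup [set \int[leb N]_(x in M) (divergence phi x)%:E
            | phi in test_field Omega].

(* De Giorgi: finite perimeter in every bounded open set.                     *)
Definition locally_finite_perimeter M :=
  leb_measurable M /\
  forall Omega : set 'rV[R]_N, open Omega -> bounded_set Omega ->
    perimeter_in Omega M < +oo.

Definition weighted_volume g M : \bar R := \int[leb N]_(x in M) (g x)%:E.

Definition weighted_perimeter f M : \bar R :=
  \int[hausdorff N.-1 N]_(x in essential_boundary M) (f x)%:E.

Definition admissible g (d : R) : set (set 'rV[R]_N) :=
  [set M | locally_finite_perimeter M /\ weighted_volume g M = d%:E].

Definition isoperimetric_solution f g (d : R) M :=
  admissible g d M /\
  weighted_perimeter f M = ereal_inf (weighted_perimeter f @` admissible g d).

End perimeter.

(* Main.v *)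
Require Import Defs.
From mathcomp Require Import all_boot all_order all_algebra.
From mathcomp Require Import all_classical all_reals all_analysis.
From mathcomp Require Import measurable_realfun.
From mathcomp Require Import ring lra.
Import Order.TTheory GRing.Theory Num.Theory.
Import numFieldNormedType.Exports.
Local Open Scope classical_set_scope.
Local Open Scope ring_scope.

Set Implicit Arguments.
Unset Strict Implicit.
Unset Printing Implicit Defensive.

(** The infimum is zero, and no admissible set has weighted perimeter zero.

    The infimum is zero.  Consider the cubes ]t, t + r]^N with t large.  On a
    doubling cube ]s, 2 s]^N the mass of g is at least a constant times
    s^(N - beta), hence bounded below since beta <= N; stacking such cubes
    along the diagonal shows that ]t, t + r]^N has mass at least d for some r
    which is a multiple of t by a factor independent of t ([volume_dyadic]),
    and by continuity in r some smaller r gives mass exactly d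
    ([volume_attains]).  On that cube g is at least a constant times
    t^(- beta), so r^N is at most a constant times t^beta
    ([side_pow_le]), whereas f is at most a constant times t^(- alpha) on its
    boundary.  The weighted perimeter is therefore at most a constant times
    t^(- alpha) r^(N - 1), that is t^((N - 1) / N beta - alpha), which tends
    to zero ([small_perimeter_diag_cube]).

    Zero is not attained.  As f is positive, weighted perimeter zero means that
    the essential boundary of M is negligible for the Hausdorff measure of
    dimension N - 1.  Then M or its complement is Lebesgue-null
    ([null_boundary_trivial]).  In the first case the mass of M is zero, in the
    second case it is infinite, because the cubes above have unbounded mass;
    neither is d.

    The rigidity statement is proved by slicing.  A negligible boundary has null
    projections along the axes, so almost every line parallel to an axis
    consists of points where either M or its complement has density zero.  Both
    kinds cannot occur on the same line, for almost every line.  Indeed, the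
    two kinds of points form two sigma-closed sets: a point of density zero is
    thin, with a fixed small constant, at all scales below some 1 / (k + 1), and
    this is a closed condition.  If both kinds occurred, the Baire category
    theorem on the frontier would produce a point, thin for one of the two sets
    at all scales below some dl, at which a segment of points of the other kind
    ends ([line_dichotomy]).  But such ends of segments project to a null set
    ([one_sided_proj_null]): near an almost extremal one of them, the segments
    that start from its neighbours fill a fixed fraction of the volume of a
    small cube with points of the wrong kind.  So on almost every line M has
    density zero everywhere or full density everywhere; the mass of M in a cube
    is then unchanged when the cube is translated ([translation_density]), and
    one point of density zero makes all points so, whence M is null
    ([density0_null]). *)

(** * Covers, coordinates and half-spaces *)

Section cover_facts.
Local Open Scope ereal_scope.
Context {R : realType} {T I : Type} (E : I -> set T) (w : I -> \bar R).

Lemma cover_outer_lt X c : cover_outer E w X < c ->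
  exists2 F, covers E X F & \sum_(k <oo) oapp w 0 (F k) < c.
Proof. by move=> /ereal_inf_lt[_ [F XF <-] lt]; exists F. Qed.

Lemma cover_outer_le X F : covers E X F ->
  cover_outer E w X <= \sum_(k <oo) oapp w 0 (F k).
Proof. by move=> XF; apply: ereal_inf_lbound; exists F. Qed.

Lemma cover_outer_single i : (forall j, 0 <= w j) -> cover_outer E w (E i) <= w i.
Proof.
move=> w0.
apply: le_trans (cover_outer_le (F := fun k => if k is 0%N then Some i else None) _) _.
  by move=> x Ex; exists 0%N.
rewrite nneseries_recl//=; last by case=> [_|k _] /=.
by rewrite eseries_cond/= eseries0 ?adde0// => -[|].
Qed.

End cover_facts.

Section coordinates.
Context {R : realType}.

(** Replaces one coordinate; moving a face of a box is [setcoord] on a corner. *)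
Definition setcoord n (x : 'rV[R]_n) (i : 'I_n) (c : R) : 'rV[R]_n :=
  \row_j (if j == i then c else x ord0 j).

Lemma setcoordE n (x : 'rV[R]_n) i c j :
  setcoord x i c ord0 j = if j == i then c else x ord0 j.
Proof. by rewrite mxE. Qed.

(** [insert i t] parametrizes the hyperplane where the i-th coordinate is t, and
    [drop_coord i] is the projection along the i-th axis. *)
Definition insert n (i : 'I_n.+1) (t : R) (p : 'rV[R]_n) : 'rV[R]_n.+1 :=
  \row_j (if unlift i j is Some k then p ord0 k else t).

Definition drop_coord n (i : 'I_n.+1) (x : 'rV[R]_n.+1) : 'rV[R]_n :=
  \row_k x ord0 (lift i k).

Lemma insert_at n (i : 'I_n.+1) t p : insert i t p ord0 i = t.
Proof. by rewrite mxE unlift_none. Qed.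

Lemma insert_lift n (i : 'I_n.+1) t p k : insert i t p ord0 (lift i k) = p ord0 k.
Proof. by rewrite mxE liftK. Qed.

Lemma drop_coordE n (i : 'I_n.+1) x k : drop_coord i x ord0 k = x ord0 (lift i k).
Proof. by rewrite mxE. Qed.

Lemma insertK n (i : 'I_n.+1) t : cancel (insert i t) (drop_coord i).
Proof. by move=> p; apply/rowP => k; rewrite drop_coordE insert_lift. Qed.

Lemma drop_coordK n (i : 'I_n.+1) (x : 'rV[R]_n.+1) : insert i (x ord0 i) (drop_coord i x) = x.
Proof.
apply/rowP => j; case: (unliftP i j) => [k ->|->].
  by rewrite insert_lift drop_coordE.
by rewrite insert_at.
Qed.

Lemma forall_lift n (i : 'I_n.+1) (P : 'I_n.+1 -> Prop) :
  P i -> (forall k, P (lift i k)) -> forall j, P j.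
Proof. by move=> Pi Pl j; case: (unliftP i j) => [k ->|->]. Qed.

Lemma box_insert n (i : 'I_n.+1) t p (ab : 'rV[R]_n.+1 * 'rV[R]_n.+1) :
  box ab (insert i t p) <->
  (ab.1 ord0 i < t <= ab.2 ord0 i) /\
  box (drop_coord i ab.1, drop_coord i ab.2) p.
Proof.
split=> [bx|[ti bx]].
  split; first by have := bx i; rewrite insert_at.
  by move=> k /=; have := bx (lift i k); rewrite insert_lift !drop_coordE.
apply: (forall_lift (i := i)); first by rewrite insert_at.
by move=> k; rewrite insert_lift; have := bx k; rewrite /= !drop_coordE.
Qed.

Lemma box_vol_drop n (i : 'I_n.+1) (ab : 'rV[R]_n.+1 * 'rV[R]_n.+1) :
  (box_vol ab = (Num.max 0 (ab.2 ord0 i - ab.1 ord0 i))%:E *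
   box_vol (drop_coord i ab.1, drop_coord i ab.2))%E.
Proof.
rewrite /box_vol -EFinM; congr EFin; rewrite (bigD1_ord i)//=; congr (_ * _).
by apply: eq_bigr => k _; rewrite !drop_coordE.
Qed.

End coordinates.

Section lebesgue_basics.
Context {R : realType}.
Implicit Types n : nat.
Local Open Scope ereal_scope.

Lemma leb_outer_box_le n (ab : 'rV[R]_n * 'rV[R]_n) :
  leb_outer (box ab) <= box_vol ab.
Proof. exact/cover_outer_single/box_vol_ge0. Qed.

Lemma leb_outer_ge0 n (X : set 'rV[R]_n) : 0 <= leb_outer X.
Proof. exact: outer_measure_ge0. Qed.

Lemma le_leb_outer n (X Y : set 'rV[R]_n) : X `<=` Y -> leb_outer X <= leb_outer Y.
Proof. exact: le_outer_measure. Qed.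

Lemma leb_outer_null_sub n (X Y : set 'rV[R]_n) :
  X `<=` Y -> leb_outer Y = 0 -> leb_outer X = 0.
Proof.
move=> XY Y0; apply/eqP; rewrite eq_le leb_outer_ge0 andbT -Y0.
exact: le_leb_outer.
Qed.

Lemma leb_outerU n (X Y : set 'rV[R]_n) :
  leb_outer (X `|` Y) <= leb_outer X + leb_outer Y.
Proof. exact: outer_measureU2. Qed.

Lemma outer_bigcup_null T (mu : {outer_measure set T -> \bar R}) (F : nat -> set T) :
  (forall k, mu (F k) = 0) -> mu (\bigcup_k F k) = 0.
Proof.
move=> F0; apply/eqP; rewrite eq_le outer_measure_ge0 andbT.
by apply: le_trans (outer_measure_sigma_subadditive mu F) _; rewrite eseries0.
Qed.

Lemma outer_bigcup_countable_null T (I : countType)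
    (mu : {outer_measure set T -> \bar R}) (F : I -> set T) :
  (forall k, mu (F k) = 0) -> mu (\bigcup_k F k) = 0.
Proof.
move=> F0.
have := @outer_bigcup_null _ mu (fun k => oapp F set0 (unpickle k)).
have -> : \bigcup_k oapp F set0 (unpickle k) = \bigcup_k F k.
  apply/seteqP; split=> [x [k _]|x [k _ Fx]].
    by case: (unpickle k) => //= i Fx; exists i.
  by exists (pickle k) => //=; rewrite pickleK.
by apply=> k; case: unpickle => //=.
Qed.

(** The volume of a box is additive under cutting by a coordinate hyperplane,
    because max 0 (b - a) is additive when [a, b] is cut at c, even when c is
    outside the interval or the interval is empty. *)
Lemma box_vol_cut n (i : 'I_n) c (ab : 'rV[R]_n * 'rV[R]_n) :
  box_vol ab = box_vol (ab.1, setcoord ab.2 i (Num.min (ab.2 ord0 i) c)) +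
               box_vol (setcoord ab.1 i (Num.max (ab.1 ord0 i) c), ab.2).
Proof.
rewrite /box_vol -EFinD; congr EFin.
rewrite (bigD1 i)//= [X in _ = (X + _)%R](bigD1 i)//= [X in _ = (_ + X)%R](bigD1 i)//=.
rewrite !setcoordE eqxx.
have E (x y z : 'rV[R]_n) : (forall j, j != i -> (y ord0 j - x ord0 j = z ord0 j)%R) ->
    (\prod_(j < n | j != i) Num.max 0 (y ord0 j - x ord0 j) =
     \prod_(j < n | j != i) Num.max 0 (z ord0 j))%R.
  by move=> h; apply: eq_bigr => j ji; rewrite h.
rewrite (E ab.1 ab.2 (ab.2 - ab.1)%R); last by move=> j _; rewrite !mxE.
rewrite (E ab.1 _ (ab.2 - ab.1)%R); last first.
  by move=> j ji; rewrite setcoordE (negPf ji) !mxE.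
rewrite (E _ ab.2 (ab.2 - ab.1)%R); last first.
  by move=> j ji; rewrite setcoordE (negPf ji) !mxE.
rewrite -mulrDl; congr (_ * _)%R.
move: (ab.1 ord0 i) (ab.2 ord0 i) => a b.
by rewrite /Num.max /Num.min; repeat case: ifPn; rewrite -?leNgt; lra.
Qed.

Definition halfspace n (i : 'I_n) (c : R) : set 'rV[R]_n :=
  [set x | (x ord0 i <= c)%R].

Lemma box_halfspace n (i : 'I_n) c (ab : 'rV[R]_n * 'rV[R]_n) :
  box ab `&` halfspace i c = box (ab.1, setcoord ab.2 i (Num.min (ab.2 ord0 i) c)).
Proof.
apply/seteqP; split=> [x [bx hx] j|x bx] /=.
  rewrite setcoordE; case: eqP => [->|_]; last exact: bx.
  by rewrite le_min hx; have /andP[-> ->] := bx i.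
split=> [j|].
  have := bx j; rewrite /= setcoordE; case: eqP => [->|_//].
  by rewrite le_min => /and3P[-> ->].
have := bx i; rewrite /= setcoordE eqxx le_min.
by move=> /and3P[].
Qed.

Lemma box_halfspaceC n (i : 'I_n) c (ab : 'rV[R]_n * 'rV[R]_n) :
  box ab `&` ~` halfspace i c = box (setcoord ab.1 i (Num.max (ab.1 ord0 i) c), ab.2).
Proof.
apply/seteqP; split=> [x [bx hx] j|x bx] /=.
  rewrite setcoordE; case: eqP => [->|_]; last exact: bx.
  rewrite gt_max; have /andP[-> ->] := bx i; move/negP: hx.
  by rewrite -ltNge => ->.
split=> [j|].
  have := bx j; rewrite /= setcoordE; case: eqP => [->|_//].
  by rewrite gt_max => /andP[/andP[-> _] ->].
have := bx i; rewrite /= setcoordE eqxx gt_max => /andP[/andP[_ h] _].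
by apply/negP; rewrite -ltNge.
Qed.

(** Cutting every box of a cover along the hyperplane gives covers of the two
    parts of X with the same total volume. *)
Lemma leb_halfspace n (i : 'I_n) c : leb_measurable (@halfspace n i c).
Proof.
apply: le_caratheodory_measurable => X.
apply: le_ereal_inf_tmp => _ [F XF <-].
pose L := fun ab : 'rV[R]_n * 'rV[R]_n =>
  (ab.1, setcoord ab.2 i (Num.min (ab.2 ord0 i) c)).
pose U := fun ab : 'rV[R]_n * 'rV[R]_n =>
  (setcoord ab.1 i (Num.max (ab.1 ord0 i) c), ab.2).
have := @cover_outer_le _ _ _ (@box R n) (@box_vol R n) (X `&` halfspace i c)
  (fun k => omap L (F k)) _.
have := @cover_outer_le _ _ _ (@box R n) (@box_vol R n) (X `&` ~` halfspace i c)
  (fun k => omap U (F k)) _.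
move=> /(_ _)/wrap[|h1].
  move=> x [/XF[k _ Fx] hx]; exists k => //; move: Fx; case: (F k) => //= ab bx.
  by rewrite /U -box_halfspaceC.
move=> /(_ _)/wrap[|h2].
  move=> x [/XF[k _ Fx] hx]; exists k => //; move: Fx; case: (F k) => //= ab bx.
  by rewrite /L -box_halfspace.
apply: le_trans (leeD h2 h1) _.
rewrite -nneseriesD; first last.
- by move=> k _ _; case: (F k) => //= ?; exact: box_vol_ge0.
- by move=> k _ _; case: (F k) => //= ?; exact: box_vol_ge0.
rewrite le_eqVlt; apply/orP; left; apply/eqP; apply: eq_eseriesr => k _.
by case: (F k) => [ab|] /=; [rewrite -box_vol_cut|rewrite adde0].
Qed.

End lebesgue_basics.

(** * Measurable sets and a Tonelli inequality for Lebesgue measure *)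

Section measurable_from_halfspaces.
Context {R : realType} {n : nat}.
Variable mu : {outer_measure set 'rV[R]_n -> \bar R}.
Hypothesis mhalf : forall i c, mu.-caratheodory (halfspace i c).
Local Notation T := (caratheodory_type mu).

(** An outer measure for which half-spaces are measurable makes all boxes, open
    sets and closed sets measurable.  The statements are used both for Lebesgue
    and for Hausdorff measure. *)
Lemma cara_box ab : measurable (box ab : set T).
Proof.
have -> : box ab = \bigcap_(i in [set: 'I_n])
    (halfspace i (ab.2 ord0 i) `&` ~` halfspace i (ab.1 ord0 i)).
  apply/seteqP; split=> [x bx i _|x bx i] /=.
    have /andP[h1 h2] := bx i; split=> //.
    by apply/negP; rewrite -ltNge.
  have [h1 h2] := bx i I; apply/andP; split=> //.
  by rewrite ltNge; exact/negP.
apply: (@fin_bigcap_measurable _ T); first exact: finite_finset.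
move=> i _; apply: (@measurableI _ T); first exact: mhalf.
by apply: (@measurableC _ T); exact: mhalf.
Qed.

(** An open set is the countable union of the boxes with rational corners that it
    contains. *)
Lemma cara_open (U : set 'rV[R]_n) : open U -> measurable (U : set T).
Proof.
move=> oU.
pose q (p : 'rV[rat]_n * 'rV[rat]_n) : 'rV[R]_n * 'rV[R]_n :=
  (map_mx ratr p.1, map_mx ratr p.2).
have -> : U = \bigcup_p (if `[< box (q p) `<=` U >] then box (q p) else set0).
  apply/seteqP; split=> [x Ux|x [p _]]; last by case: asboolP => // h /h.
  have /nbhs_ballP[e /= e0 eU] := open_nbhs_nbhs (conj oU Ux).
  have /choice[a ha] : forall i : 'I_n, exists a : rat,
      ratr a \in `]x ord0 i - e, x ord0 i[.
    by move=> i; apply: rat_in_itvoo; rewrite gtrBl.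
  have /choice[b hb] : forall i : 'I_n, exists a : rat,
      ratr a \in `]x ord0 i, x ord0 i + e[.
    by move=> i; apply: rat_in_itvoo; rewrite ltrDl.
  exists (\row_i a i, \row_i b i) => //; rewrite asboolT.
    move=> i; rewrite /= !mxE; have := ha i; have := hb i.
    by rewrite !in_itv/= => /andP[/ltW -> _] /andP[_ ->].
  move=> y by_; apply: eU; split=> // i j; rewrite (ord1 i).
  have := by_ j; rewrite /= !mxE => /andP[h1 h2].
  have := ha j; have := hb j; rewrite !in_itv/= => /andP[_ h3] /andP[h4 _].
  rewrite /ball/= ltr_distlC; apply/andP; split; first exact: lt_trans h1.
  exact: le_lt_trans h3.
apply: (@countable_bigcupT_measurable _ T); first exact: countableP.
by move=> p; case: ifP => _; [exact: cara_box|exact: (@measurable0 _ T)].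
Qed.

Lemma cara_closed (U : set 'rV[R]_n) : closed U -> measurable (U : set T).
Proof.
move=> /closed_openC/cara_open h; rewrite -(setCK U).
exact: (@measurableC _ T).
Qed.

End measurable_from_halfspaces.

Section half_tonelli.
Context {R : realType}.
Local Open Scope ereal_scope.

Lemma leb_outer_le_cover n (X : set 'rV[R]_n) F : covers (@box R n) X F ->
  leb_outer X <= \sum_(k <oo) oapp (@box_vol R n) 0 (F k).
Proof. exact: cover_outer_le. Qed.

(** One half of Tonelli's theorem, valid for arbitrary X: slicing a cover of X by
    boxes gives covers of all slices at once, so the total volume of the cover is
    at least the integral over T of the outer measures of the slices. *)
Lemma half_tonelli n (i : 'I_n.+1) (X : set 'rV[R]_n.+1) (T : set (measurableTypeR R)) (c : R) :
  (0 <= c)%R -> measurable T ->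
  (forall t, T t -> c%:E <= leb_outer [set p | X (insert i t p)]) ->
  c%:E * lebesgue_measure T <= leb_outer X.
Proof.
move=> c0 mT cX; apply: le_ereal_inf_tmp => _ [F XF <-].
pose I (ab : 'rV[R]_n.+1 * 'rV[R]_n.+1) : set (measurableTypeR R) :=
  `]ab.1 ord0 i, ab.2 ord0 i]%classic.
have mI ab : measurable (I ab) by exact: measurable_itv.
pose v (ab : 'rV[R]_n.+1 * 'rV[R]_n.+1) :=
  box_vol (drop_coord i ab.1, drop_coord i ab.2).
pose h k (t : measurableTypeR R) : \bar R := oapp (fun ab => v ab * (\1_(I ab) t)%:E) 0 (F k).
have h0 k t : 0 <= h k t.
  by rewrite /h; case: (F k) => //= ab; rewrite mule_ge0 ?box_vol_ge0// lee_fin.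
have mh k : measurable_fun T (h k).
  rewrite /h; case: (F k) => [ab|] /=; last exact: measurable_cst.
  apply: (emeasurable_funM (measurable_cst _)).
  by apply/measurable_EFinP; apply: measurable_indic.
apply: (@le_trans _ _ (\int[lebesgue_measure]_(t in T) \sum_(k <oo) h k t)).
  rewrite -integral_cst//; apply: ge0_le_integral => //.
    by apply: ge0_emeasurable_sum => // k t _ _; exact: h0.
  move=> t Tt; apply: le_trans (cX t Tt) _.
  (* The boxes of the cover that meet the hyperplane at height t, projected. *)
  pose G k := obind (fun ab => if t \in I ab
    then Some (drop_coord i ab.1, drop_coord i ab.2) else None) (F k).
  apply: le_trans (leb_outer_le_cover (F := G) _) _.
    move=> p /= /XF[k _ Fp]; exists k => //; rewrite /G; move: Fp.
    case: (F k) => //= ab /box_insert[tab bp]; rewrite ifT//.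
    by rewrite inE /I/= in_itv.
  apply: lee_nneseries => k _.
    by move=> _; rewrite /G; case: (F k) => //= ab; case: ifP => //= _; exact: box_vol_ge0.
  rewrite /G /h; case: (F k) => //= ab; rewrite indicE.
  by case: ifP => _ /=; rewrite ?mule1 ?mule0.
rewrite integral_nneseries//; apply: lee_nneseries => k _.
  by move=> _; exact: integral_ge0.
rewrite /h; case: (F k) => [ab|] /=; last by rewrite integral0.
have vv : v ab = (fine (v ab))%:E by [].
rewrite vv ge0_integralZl_EFin//; last 2 first.
- by apply/measurable_EFinP; apply: measurable_indic.
- by rewrite fine_ge0// box_vol_ge0.
rewrite integral_indic// (box_vol_drop i) muleC -vv.
apply: lee_wpmul2r; first exact: box_vol_ge0.
apply: (@le_trans _ _ (lebesgue_measure (I ab))).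
  by apply: le_measure; rewrite ?inE//; exact: measurableI.
rewrite /I lebesgue_measure_itv/=; case: ifPn => [lt|_].
  by rewrite -EFinB lee_fin le_max lexx orbT.
by rewrite lee_fin le_max lexx.
Qed.

(** Covers of a box cannot have less than its volume: by induction on the
    dimension, since the slices of a box are boxes of a lower dimension. *)
Lemma leb_outer_box n (ab : 'rV[R]_n * 'rV[R]_n) : leb_outer (box ab) = box_vol ab.
Proof.
apply/eqP; rewrite eq_le leb_outer_box_le/=.
elim: n ab => [|n IH] ab.
  apply: le_ereal_inf_tmp => _ [F XF <-].
  have /XF[k _] : box ab 0%R by move=> [].
  case Fk: (F k) => [cd|]//= _.
  rewrite (nneseriesD1 (n := k))//; last by move=> j _; case: (F j) => //= ?; exact: box_vol_ge0.
  rewrite Fk /= /box_vol !big_ord0 leeDl//.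
  by apply: nneseries_ge0 => j _ _;  case: (F j) => //= ?; exact: box_vol_ge0.
have [le|lt] := leP (ab.2 ord0 ord0) (ab.1 ord0 ord0).
  rewrite (box_vol_drop ord0) max_l ?mul0e ?leb_outer_ge0//.
  by rewrite subr_le0.
apply: le_trans (@half_tonelli n ord0 (box ab) `]ab.1 ord0 ord0, ab.2 ord0 ord0]%classic
  (fine (box_vol (drop_coord ord0 ab.1, drop_coord ord0 ab.2))) _ _ _); last first.
- move=> t; rewrite /= in_itv/= => tab.
  rewrite [leRHS](_ : _ = leb_outer (box (drop_coord ord0 ab.1, drop_coord ord0 ab.2))).
    by apply: le_trans (IH _).
  by congr leb_outer; apply/seteqP; split=> p; rewrite /= box_insert//; case.
- exact: measurable_itv.
- by rewrite fine_ge0// box_vol_ge0.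
rewrite (box_vol_drop ord0) muleC lebesgue_measure_itv/= lte_fin lt.
by rewrite max_r// subr_ge0 ltW.
Qed.

Lemma leb_outer_translate_le n (v : 'rV[R]_n) X :
  leb_outer [set (x + v)%R | x in X] <= leb_outer X.
Proof.
apply: le_ereal_inf_tmp => _ [F XF <-].
pose G k := omap (fun ab : 'rV[R]_n * 'rV[R]_n => (ab.1 + v, ab.2 + v)%R) (F k).
apply: le_trans (leb_outer_le_cover (F := G) _) _.
  move=> _ [x /XF[k _ Fx] <-]; exists k => //; rewrite /G; move: Fx.
  case: (F k) => //= ab bx j; rewrite /= !mxE !ltrD2r !lerD2r; exact: bx.
rewrite le_eqVlt; apply/orP; left; apply/eqP; apply: eq_eseriesr => k _.
rewrite /G; case: (F k) => //= ab; rewrite /box_vol; congr EFin.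
by apply: eq_bigr => j _; rewrite /= !mxE; congr Num.max; ring.
Qed.

Lemma leb_outer_translate n (v : 'rV[R]_n) X :
  leb_outer [set (x + v)%R | x in X] = leb_outer X.
Proof.
apply/eqP; rewrite eq_le leb_outer_translate_le/=.
apply: le_trans (leb_outer_translate_le (- v) _).
apply: le_leb_outer => x Xx; exists (x + v)%R; last by rewrite addrK.
by exists x.
Qed.

Lemma leb_outer_cylinder_null n (i : 'I_n.+1) (Z : set 'rV[R]_n) :
  leb_outer Z = 0 -> leb_outer (drop_coord i @^-1` Z) = 0.
Proof.
move=> Z0.
have -> : drop_coord i @^-1` Z = \bigcup_m
    [set x | Z (drop_coord i x) /\ (- m%:R < x ord0 i <= m%:R)%R].
  apply/seteqP; split=> [x Zx|x [m _ []//]].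
  exists (Num.bound `|x ord0 i|) => //=; split=> //.
  have h := archi_boundP (normr_ge0 (x ord0 i)).
  have := ler_norm (x ord0 i); have := ler_norm (- x ord0 i); rewrite normrN.
  by move=> h1 h2; apply/andP; split; [rewrite ltrNl|]; lra.
apply: (outer_bigcup_null (mu := @leb_outer R n.+1)) => m.
apply/eqP; rewrite eq_le outer_measure_ge0 andbT.
apply/lee_addgt0Pr => e e0; rewrite add0e.
have m0 : (0 < m%:R + 1 :> R)%R by rewrite ltr_wpDl.
have : leb_outer Z < (e / (2 * (m%:R + 1)))%:E.
  by rewrite Z0 lte_fin divr_gt0// mulr_gt0.
move=> /cover_outer_lt[F ZF lt].
(* Each box of a cover of Z with small total volume becomes a cylinder whose
   height exceeds the height 2 m of the truncated cylinder over Z. *)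
pose G k := omap (fun ab => (insert i (- (m%:R + 1)) ab.1, insert i (m%:R + 1) ab.2)%R) (F k).
apply: le_trans (leb_outer_le_cover (F := G) _) _.
  move=> x [/ZF[k _ Fx] mx]; exists k => //; rewrite /G; move: Fx.
  case: (F k) => //= ab bx; rewrite -(drop_coordK i x); apply/box_insert.
  rewrite /= !insert_at !insertK; split; last by case: ab bx.
  by apply/andP; split; lra.
have -> : \sum_(k <oo) oapp (@box_vol R n.+1) 0%R (G k) =
   \sum_(k <oo) ((2 * (m%:R + 1))%:E * oapp (@box_vol R n) 0%R (F k)).
  apply: eq_eseriesr => k _; rewrite /G; case: (F k) => [ab|] /=; rewrite ?mule0//.
  rewrite (box_vol_drop i) /= !insert_at !insertK; case: ab => a b; congr (_ * _).
  by congr EFin; rewrite max_r; lra.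
rewrite nneseriesZl; last first.
  by move=> k _; case: (F k) => //= ?; exact: box_vol_ge0.
rewrite -lee_pdivlMl ?mulr_gt0//; apply: le_trans (ltW lt) _.
by rewrite -EFinM lee_fin mulrC.
Qed.

End half_tonelli.

(** * From boxes of bounded shape to all boxes *)

Section fat_boxes.
Context {R : realType}.
Local Open Scope ereal_scope.

(** Halving a length s repeatedly ends in the window [eta / 2, eta]. *)
Lemma dyadic_scale (eta s : R) : (0 < eta)%R -> (eta / 2 <= s)%R ->
  exists m : nat, (eta / 2 * 2 ^+ m <= s <= eta * 2 ^+ m)%R.
Proof.
move=> eta0 es.
have ex : exists m : nat, (s <= eta * 2 ^+ m)%R.
  exists (Num.bound `|s / eta|%R); rewrite mulrC -ler_pdivrMr//.
  apply: le_trans (ler_norm _) _; apply: ltW.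
  apply: (lt_trans (archi_boundP (normr_ge0 _))).
  by rewrite -natrX ltr_nat ltn_expl.
case: (ex_minnP ex) => m hm min; exists m; rewrite hm andbT.
case: m hm min => [|m] hm min; first by rewrite expr0 mulr1.
have : ~~ (s <= eta * 2 ^+ m)%R by apply/negP => /min; rewrite ltnn.
rewrite -ltNge => /ltW; apply: le_trans.
by rewrite exprS mulrA divfK.
Qed.

Lemma box_cutU n (i : 'I_n) c (ab : 'rV[R]_n * 'rV[R]_n) :
  box ab = box (ab.1, setcoord ab.2 i (Num.min (ab.2 ord0 i) c)) `|`
           box (setcoord ab.1 i (Num.max (ab.1 ord0 i) c), ab.2).
Proof. by rewrite -box_halfspace -box_halfspaceC -setIUr setUv setIT. Qed.

Variables (n : nat) (nu : set 'rV[R]_n -> \bar R) (c : R).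
Hypothesis c0 : (0 <= c)%R.
Hypothesis nuU : forall A B, nu (A `|` B) <= nu A + nu B.

(** Bisecting sides repeatedly splits any box into boxes all of whose sides lie
    in the window [eta / 2, eta], and both sides of the inequality behave well
    under bisection: nu is subadditive and the volume is additive.  The induction
    is on the total number of bisections. *)
Lemma fat_boxes_scale (eta : R) : (0 < eta)%R ->
  (forall ab : 'rV[R]_n * 'rV[R]_n, (forall i, eta / 2 <= ab.2 ord0 i - ab.1 ord0 i <= eta)%R ->
    nu (box ab) <= c%:E * box_vol ab) ->
  forall ab : 'rV[R]_n * 'rV[R]_n, (forall i, eta / 2 <= ab.2 ord0 i - ab.1 ord0 i)%R ->
    nu (box ab) <= c%:E * box_vol ab.
Proof.
move=> eta0 base.
suff H K : forall m : 'I_n -> nat, (\sum_i m i = K)%N -> forall ab : 'rV[R]_n * 'rV[R]_n,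
    (forall i, eta / 2 * 2 ^+ m i <= ab.2 ord0 i - ab.1 ord0 i <= eta * 2 ^+ m i)%R ->
    nu (box ab) <= c%:E * box_vol ab.
  move=> ab hab; have /choice[m hm] := fun i => dyadic_scale eta0 (hab i).
  exact: (H _ m erefl).
elim: K => [|K IH] m.
  move=> /eqP; rewrite sum_nat_eq0 => /forallP m0 ab hab; apply: base => i.
  by have := hab i; have /eqP -> := m0 i; rewrite expr0 !mulr1.
move=> mK ab hab.
have [i mi] : exists i, (0 < m i)%N.
  apply/existsP; apply: contraT; rewrite negb_exists => /forallP h.
  move: mK; rewrite big1// => i _; apply/eqP; rewrite -leqn0 leqNgt; exact: h.
pose m' j := if j == i then (m i).-1 else m j.
have m'K : (\sum_j m' j = K)%N.
  move: mK; rewrite (bigD1 i)//= [in X in _ -> X](bigD1 i)//= /m' eqxx.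
  rewrite -(prednK mi) addSn => -[<-] /=; congr addn.
  by apply: eq_bigr => j /negPf ->.
set a := ab.1 ord0 i; set b := ab.2 ord0 i.
pose z := ((a + b) / 2)%R.
have /andP[h1 h2] := hab i.
have E2 : (2 ^+ m i = 2 * 2 ^+ m' i :> R)%R by rewrite /m' eqxx -exprS prednK.
have p2 : (0 < (2 : R) ^+ m' i)%R by rewrite exprn_gt0.
rewrite -/a -/b E2 in h1 h2.
have az : (a < z)%R.
  have : (0 < eta / 2 * (2 * 2 ^+ m' i))%R by rewrite !mulr_gt0.
  by rewrite /z; lra.
have zb : (z < b)%R by move: az; rewrite /z; lra.
rewrite (box_cutU i z) (box_vol_cut i z) muleDr//.
apply: le_trans (nuU _ _) _; apply: leeD.
  apply: (IH m' m'K) => j /=; rewrite setcoordE; case: eqP => [->|/eqP ji].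
    rewrite -/a -/b min_r ?(ltW zb)//; apply/andP; split; rewrite /z; lra.
  by have := hab j; rewrite /m' (negPf ji).
apply: (IH m' m'K) => j /=; rewrite setcoordE; case: eqP => [->|/eqP ji].
  rewrite -/a -/b max_r ?(ltW az)//; apply/andP; split; rewrite /z; lra.
by have := hab j; rewrite /m' (negPf ji).
Qed.

(** A subadditive set function is bounded by c times the volume on all boxes as
    soon as it is so on small fat boxes, those whose sides are comparable within a
    factor 2.  Fat boxes are comparable to cubes, to which pointwise information
    at all small scales applies; the scheme replaces covering theorems. *)
Lemma fat_boxes (r0 : R) : (0 < r0)%R -> nu set0 <= 0 ->
  (forall eta (ab : 'rV[R]_n * 'rV[R]_n), (0 < eta < r0)%R ->
    (forall i, eta / 2 <= ab.2 ord0 i - ab.1 ord0 i <= eta)%R ->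
    nu (box ab) <= c%:E * box_vol ab) ->
  forall ab, nu (box ab) <= c%:E * box_vol ab.
Proof.
move=> r00 nu0 base ab.
have [[i hi]|/forallNP pos] := pselect (exists i, (ab.2 ord0 i <= ab.1 ord0 i)%R).
  rewrite (_ : box ab = set0); last first.
    apply/seteqP; split=> // x /(_ i) /andP[h1 h2].
    by have := lt_le_trans h1 (le_trans h2 hi); rewrite ltxx.
  by apply: le_trans nu0 _; rewrite mule_ge0 ?box_vol_ge0.
pose eta := \big[Num.min/(r0 / 2)%R]_(i < n) (ab.2 ord0 i - ab.1 ord0 i)%R.
have eta0 : (0 < eta)%R.
  rewrite /eta; elim/big_ind: _ => [|x y x0 y0|i _]; first exact: divr_gt0.
    by rewrite lt_min x0 y0.
  by rewrite subr_gt0 ltNge; apply/negP; exact: pos.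
have etar : (eta <= r0 / 2)%R by exact: bigmin_le_id.
apply: (fat_boxes_scale eta0) => [cd hcd|i].
  by apply: (base eta) => //; rewrite eta0/=; lra.
have : (eta <= ab.2 ord0 i - ab.1 ord0 i)%R by exact: bigmin_le.
lra.
Qed.

End fat_boxes.

Section null_criterion.
Context {R : realType}.
Local Open Scope ereal_scope.

Definition cube n (x : 'rV[R]_n) (r : R) : set 'rV[R]_n :=
  box (\row_i (x ord0 i - r), \row_i (x ord0 i + r))%R.

Lemma cubeP n (x : 'rV[R]_n) r y :
  cube x r y <-> forall i, (x ord0 i - r < y ord0 i <= x ord0 i + r)%R.
Proof. by split=> h i; have := h i; rewrite /= !mxE. Qed.

Lemma leb_outer_cube n (x : 'rV[R]_n) r : (0 <= r)%R ->
  leb_outer (cube x r) = ((2 * r) ^+ n)%:E.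
Proof.
move=> r0; rewrite leb_outer_box /box_vol; congr EFin.
rewrite (eq_bigr (fun=> 2 * r)%R) ?prodr_const ?card_ord// => i _.
by rewrite /= !mxE max_r; lra.
Qed.

Lemma coord_le_norm n (x : 'rV[R]_n) i : (`|x ord0 i| <= `|x|)%R.
Proof.
rewrite [leRHS]mx_normrE.
exact: (le_bigmax _ (fun ij : 'I_1 * 'I_n => `|x ij.1 ij.2|%R) (ord0, i)).
Qed.

(** If Y fills at most half of every small fat box, then it fills at most half of
    every box, and a cover by boxes that is almost optimal for Y yields
    m <= m / 2 for the measure m of any bounded part of Y. *)
Lemma leb_outer_null_criterion n (Y : set 'rV[R]_n) (r0 : R) : (0 < r0)%R ->
  (forall eta (ab : 'rV[R]_n * 'rV[R]_n), (0 < eta < r0)%R ->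
    (forall i, eta / 2 <= ab.2 ord0 i - ab.1 ord0 i <= eta)%R ->
    leb_outer (Y `&` box ab) <= (1/2)%:E * box_vol ab) ->
  leb_outer Y = 0.
Proof.
move=> r00 base.
have all ab : leb_outer (Y `&` box ab) <= (1/2)%:E * box_vol ab.
  apply: (@fat_boxes R n (fun A => leb_outer (Y `&` A)) _ _ _ r0) => //.
  - by move=> A B; rewrite setIUr; exact: leb_outerU.
  - by rewrite setI0 (outer_measure0 (@leb_outer R n)).
have -> : Y = \bigcup_k (Y `&` cube 0%R k.+1%:R).
  apply/seteqP; split=> [x Yx|x [k _ []//]].
  exists (Num.bound `|x|%R) => //; split=> //; apply/cubeP => i.
  have h : (`|x ord0 i| <= `|x|)%R.
    exact: coord_le_norm.
  have h2 := archi_boundP (normr_ge0 x).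
  have := ler_norm (x ord0 i); have := ler_norm (- x ord0 i)%R.
  rewrite normrN !mxE -natr1; move=> *; apply/andP; split; lra.
apply: (outer_bigcup_null (mu := @leb_outer R n)) => k.
set C := cube _ _; set m := leb_outer (Y `&` C).
have m0 : 0 <= m by exact: leb_outer_ge0.
have mfin : m \is a fin_num.
  rewrite ge0_fin_numE//; apply: le_lt_trans (le_leb_outer (@subIsetr _ _ _)) _.
  by rewrite leb_outer_cube// ltry.
suff : m <= (1/2)%:E * m.
  move=> h; apply/eqP; rewrite eq_le m0 andbT.
  change (m <= 0); move: h m0 mfin; clearbody m; case: m => [r||]//.
  by rewrite -EFinM !lee_fin => h r00' _; lra.
apply/lee_addgt0Pr => e e0.
have : leb_outer (Y `&` C) < m + e%:E by rewrite lteDl// lte_fin.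
move=> /cover_outer_lt[F YF lt].
apply: (@le_trans _ _ (leb_outer (\bigcup_j (Y `&` oapp (@box R n) set0 (F j))))).
  by apply: le_leb_outer => x [Yx Cx]; have [j _ Fx] := YF x (conj Yx Cx); exists j.
apply: le_trans (outer_measure_sigma_subadditive (@leb_outer R n) _) _.
apply: (@le_trans _ _ (\sum_(j <oo) ((1/2)%:E * oapp (@box_vol R n) 0 (F j)))).
  apply: lee_nneseries => j _; first by move=> _; exact: leb_outer_ge0.
  case: (F j) => [ab|] /=; first exact: all.
  by rewrite setI0 (outer_measure0 (@leb_outer R n)) mule0.
rewrite nneseriesZl; last first.
  by move=> j _; case: (F j) => //= ?; exact: box_vol_ge0.
apply: (@le_trans _ _ ((1/2)%:E * (m + e%:E))).
  by apply: lee_wpmul2l => //; exact: ltW.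
rewrite -(fineK mfin) -EFinD -!EFinM -EFinD lee_fin; lra.
Qed.

End null_criterion.

(** * Points of density zero *)

Section density_points.
Context {R : realType}.
Local Open Scope ereal_scope.
Implicit Types n : nat.

(** M occupies at most a proportion eps of the scale r^n in the cubes centred at
    x, at all scales below dl.  For fixed eps and dl this is a closed condition on
    x; density zero is a countable combination of such conditions. *)
Definition thin n (M : set 'rV[R]_n) (eps dl : R) : set 'rV[R]_n :=
  [set x | forall r, (0 < r < dl)%R ->
    leb_outer (M `&` cube x r) <= (eps * r ^+ n)%:E].

Definition density0 n (M : set 'rV[R]_n) : set 'rV[R]_n :=
  [set x | forall eps, (0 < eps)%R -> exists2 dl, (0 < dl)%R & thin M eps dl x].

(** A threshold for [thin] small compared with the volume (eta / 2)^n of a fat box,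
    with a factor 16 to spare. *)
Definition thin_level n : R := (2 ^- (n + 4))%R.

Lemma thin_level_gt0 n : (0 < thin_level n)%R.
Proof. by rewrite invr_gt0 exprn_gt0. Qed.

Lemma thin_le n (M : set 'rV[R]_n) eps d1 d2 : (d1 <= d2)%R ->
  thin M eps d2 `<=` thin M eps d1.
Proof.
move=> d12 x h r /andP[r0 r1]; apply: h; rewrite r0/=; exact: lt_le_trans d12.
Qed.

Lemma density0_thin n (M : set 'rV[R]_n) x eps : (0 < eps)%R -> density0 M x ->
  exists k : nat, thin M eps k.+1%:R^-1 x.
Proof.
move=> e0 /(_ _ e0)[d d0 hd].
exists (Num.bound d^-1); apply: thin_le hd.
rewrite invf_ple ?posrE//.
apply: le_trans (ltW (archi_boundP _)) _; first by rewrite invr_ge0 ltW.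
by rewrite ler_nat.
Qed.

Lemma fat_box_vol n eta (ab : 'rV[R]_n * 'rV[R]_n) : (0 < eta)%R ->
  (forall i, eta / 2 <= ab.2 ord0 i - ab.1 ord0 i <= eta)%R ->
  ((eta / 2) ^+ n)%:E <= box_vol ab.
Proof.
move=> eta0 h; rewrite lee_fin.
rewrite -[n in X in (X <= _)%R]card_ord -prodr_const.
apply: ler_prod => i _; have /andP[h1 h2] := h i.
by rewrite le_max h1 orbT divr_ge0// ltW.
Qed.

Lemma fat_box_thin_bound n (eta c : R) : (0 < eta)%R -> (c <= 8 * (thin_level n * eta ^+ n))%R ->
  (c <= 1 / 2 * (eta / 2) ^+ n)%R.
Proof.
move=> e0 /le_trans; apply; rewrite /thin_level exprMn exprVn exprD invfM.
have : (2 ^+ 4 = 16 :> R)%R by rewrite -natrX.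
move=> ->; have h : (0 <= 2 ^- n * eta ^+ n :> R)%R.
  by rewrite mulr_ge0 ?invr_ge0 ?exprn_ge0 ?ltW.
rewrite (_ : 8 * _ = 1/2 * (2 ^- n * eta ^+ n))%R; last by field; rewrite expf_neq0.
by rewrite [(2 ^- n * _)%R]mulrC.
Qed.

(** Half of Lebesgue's density theorem, for arbitrary M.  The part of M that is thin
    below a fixed scale fills little of any small fat box, because a box that meets it lies
    in a cube centred at one of its points. *)
Lemma density0_null n (M : set 'rV[R]_n) : leb_outer (M `&` density0 M) = 0.
Proof.
apply: (@leb_outer_null_sub _ _ _ (\bigcup_k (M `&` thin M (thin_level n) k.+1%:R^-1))).
  move=> x [Mx /(density0_thin (thin_level_gt0 n))[k hk]]; by exists k.
apply: (outer_bigcup_null (mu := @leb_outer R n)) => k.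
apply: (@leb_outer_null_criterion _ _ _ k.+1%:R^-1); first by rewrite invr_gt0.
move=> eta ab /andP[eta0 etak] fat.
set Y := _ `&` thin _ _ _.
have [[z [[Mz thz] Bz]]|/forallNP ne] := pselect (exists z, (Y `&` box ab) z); last first.
  rewrite (_ : _ `&` _ = set0); last by apply/seteqP; split => // z /ne.
  by rewrite (outer_measure0 (@leb_outer R n)) mule_ge0// box_vol_ge0.
apply: (@le_trans _ _ (leb_outer (M `&` cube z eta))).
  apply: le_leb_outer => y [[My _] By]; split=> //; apply/cubeP => i.
  have := fat i; have := Bz i; have := By i => /andP[a1 a2] /andP[a3 a4] /andP[a5 a6].
  by apply/andP; split; lra.
have := thz eta; rewrite eta0 etak => /(_ isT) /le_trans; apply.
apply: (@le_trans _ _ (1/2 * (eta / 2) ^+ n)%:E).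
  rewrite lee_fin; apply: fat_box_thin_bound => //.
  have : (0 <= thin_level n * eta ^+ n)%R by rewrite mulr_ge0 ?exprn_ge0// ltW// thin_level_gt0.
  lra.
by rewrite EFinM lee_wpmul2l// fat_box_vol.
Qed.

(** M and its complement cannot both be thin at the same small cube, because their
    measures add up to at least the volume (2 r)^n of the cube. *)
Lemma thinC_density0 n (M : set 'rV[R]_n) dl x : (0 < dl)%R ->
  thin (~` M) (thin_level n) dl x -> density0 M x -> False.
Proof.
move=> dl0 th /(_ _ (thin_level_gt0 n))[d' d'0 th'].
pose r := (Num.min dl d' / 2)%R.
have m0 : (0 < Num.min dl d')%R by rewrite lt_min dl0.
have r0 : (0 < r)%R by rewrite divr_gt0.
have rm : (r < Num.min dl d')%R by rewrite /r; lra.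
move: rm; rewrite lt_min => /andP[r1 r2]; clearbody r.
have h1 := th r; rewrite r0 r1 in h1; have {}h1 := h1 isT.
have h2 := th' r; rewrite r0 r2 in h2; have {}h2 := h2 isT.
have : leb_outer (cube x r) <= (2 * (thin_level n * r ^+ n))%:E.
  apply: (@le_trans _ _ (leb_outer (M `&` cube x r) + leb_outer (~` M `&` cube x r))).
    by apply: le_trans (leb_outerU _ _); rewrite -setIUl setUv setTI.
  apply: le_trans (leeD h2 h1) _; rewrite -EFinD lee_fin; lra.
rewrite (leb_outer_cube _ (ltW r0)) lee_fin; apply/negP; rewrite -ltNge exprMn mulrA.
rewrite ltr_pM2r ?exprn_gt0//.
apply: (@lt_le_trans _ _ 1%R); last by rewrite exprn_ege1// ler1n.
rewrite /thin_level exprD invfM.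
have : (2 ^+ 4 = 16 :> R)%R by rewrite -natrX.
move=> ->.
have : (2 ^- n <= 1 :> R)%R by rewrite invf_le1 ?exprn_gt0// exprn_ege1// ler1n.
lra.
Qed.

(** From such a point starts, in the direction sg along the i-th axis, a segment of
    length dl of points of density zero for M, although the point itself has M of
    almost full density at all scales below dl. *)
Definition one_sided n (M : set 'rV[R]_n.+1) (i : 'I_n.+1) (sg dl : R) :
    set 'rV[R]_n.+1 :=
  [set x | thin (~` M) (thin_level n.+1) dl x /\
    forall t, (0 < sg * (t - x ord0 i) < dl)%R ->
      density0 M (insert i t (drop_coord i x))].

(** Cut the set into slabs of height less than dl, and let y be an end in the slab
    that is almost extremal in the direction sg among those projecting into a small
    fat box.  From every other such end starts a segment of points of density zero
    which covers the heights slightly beyond y.  By [half_tonelli], a large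
    projection would make these segments occupy a fixed fraction of the cube
    centred at y; but in this cube the points of density zero are negligible in M
    and the complement of M is thin. *)
Lemma one_sided_proj_null n (M : set 'rV[R]_n.+1) i sg dl : (0 < dl)%R ->
  sg = 1%R \/ sg = (- 1)%R ->
  leb_outer (drop_coord i @` one_sided M i sg dl) = 0.
Proof.
move=> dl0 sg1.
have sgsg : (sg * sg = 1)%R by case: sg1 => ->; rewrite ?mulr1// mulrNN mulr1.
pose w := (dl / 4)%R; have w0 : (0 < w)%R by rewrite divr_gt0.
pose slab (j : int) := one_sided M i sg dl `&`
  [set x | (j%:~R * w < sg * x ord0 i <= (j%:~R + 1) * w)%R].
apply: (@leb_outer_null_sub _ _ _ (\bigcup_(j : int) (drop_coord i @` slab j))).
  move=> _ [x Ex <-].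
  exists (Num.ceil (sg * x ord0 i / w) - 1)%R => //; exists x => //; split=> //=.
  rewrite -ltr_pdivlMr// -ler_pdivrMr// intrB subrK -intrB.
  exact: ceil_itv.
apply: (outer_bigcup_countable_null (mu := @leb_outer R n)) => j.
apply: (@leb_outer_null_criterion _ _ _ (dl / 2)); first by rewrite divr_gt0.
move=> eta ab /andP[eta0 etadl] fat.
set P := drop_coord i @` slab j.
have [[z [Pz Bz]]|/forallNP ne] := pselect (exists z, (P `&` box ab) z); last first.
  rewrite (_ : _ `&` _ = set0); last by apply/seteqP; split => // z /ne.
  by rewrite (outer_measure0 (@leb_outer R n)) mule_ge0// box_vol_ge0.
pose H : set R := [set (sg * x ord0 i)%R | x in [set x | slab j x /\ box ab (drop_coord i x)]].
have supH : has_sup H.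
  split; first by case: Pz => x sx zx; exists (sg * x ord0 i)%R, x => //; split=> //; rewrite zx.
  by exists ((j%:~R + 1) * w)%R => _ [x [[_ /andP[_ h]] _] <-].
have [_ [y [sy By] <-] ysup] : exists2 h, H h & (sup H - eta / 4 < h)%R.
  by apply: sup_adherent => //; rewrite divr_gt0.
have ymax x : slab j x -> box ab (drop_coord i x) ->
    (sg * x ord0 i <= sg * y ord0 i + eta / 4)%R.
  move=> sx Bx; rewrite -lerBlDr; apply: le_trans (ltW ysup).
  rewrite lerD2r; apply: ub_le_sup; first by case: supH.
  by exists x.
(* Heights beyond y by more than the defect eta / 4 from extremality, and by
   less than eta / 2, so that they stay in the cube centred at y. *)
pose T : set (measurableTypeR R) := [set t | (eta / 4 < sg * (t - y ord0 i) < eta / 2)%R].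
have TE : exists a, T = `]a, (a + eta / 4)%R[%classic.
  case: sg1 => sgE; [exists (y ord0 i + eta / 4)%R|exists (y ord0 i - eta / 2)%R];
  by apply/seteqP; split=> t; rewrite /T/= sgE in_itv/= => /andP[h1 h2]; apply/andP; split; lra.
have [lT mT] : lebesgue_measure T = (eta / 4)%:E /\ measurable T.
  case: TE => a ->; split; last exact: measurable_itv.
  rewrite lebesgue_measure_itv/= lte_fin ltrDl divr_gt0// -EFinD.
  by congr EFin; rewrite addrC addKr.
set PB := P `&` box ab.
have PBfin : leb_outer PB \is a fin_num.
  rewrite ge0_fin_numE ?leb_outer_ge0//.
  by apply: le_lt_trans (le_leb_outer (@subIsetr _ _ _)) _; rewrite leb_outer_box ltry.
have := @half_tonelli R n i (density0 M `&` cube y eta) T (fine (leb_outer PB)).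
rewrite fine_ge0 ?leb_outer_ge0// => /(_ isT mT).
rewrite fineK// lT => HT; have {}HT := HT _.
have up : leb_outer PB * (eta / 4)%:E <= (thin_level n.+1 * eta ^+ n.+1)%:E.
  apply: le_trans (HT _) _.
    move=> t Tt; apply: le_leb_outer => p [[x sx xp] Bp]; rewrite -xp.
    have Bx : box ab (drop_coord i x) by rewrite xp.
    have := ymax x sx Bx; case: (sx) => [[_ xd] /andP[j1 j2]] ym.
    case: (sy) => [_ /andP[j3 j4]].
    move: Tt; rewrite /T/= => /andP[t1 t2].
    have e1 : (sg * (t - x ord0 i) =
        sg * (t - y ord0 i) + (sg * y ord0 i - sg * x ord0 i))%R by ring.
    split; first by apply: xd; rewrite e1; apply/andP; split; rewrite /w in j1 j2 j3 j4; lra.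
    apply/cubeP; apply: (forall_lift (i := i)).
      rewrite insert_at; case: sg1 t1 t2 => -> t1 t2; apply/andP; split; lra.
    move=> k; rewrite insert_lift drop_coordE.
    have := Bx k; have := By k; have := fat k; rewrite !drop_coordE.
    by move=> /andP[a1 a2] /andP[a3 a4] /andP[a5 a6]; apply/andP; split; lra.
  apply: (@le_trans _ _ (leb_outer (M `&` density0 M) + leb_outer (~` M `&` cube y eta))).
    apply: le_trans (leb_outerU _ _); apply: le_leb_outer => x [dx cx].
    by have [Mx|Mx] := pselect (M x); [left|right].
  rewrite density0_null add0e; case: (sy) => [[th _] _].
  by apply: th; rewrite eta0/=; lra.
apply: (@le_trans _ _ (1/2 * (eta / 2) ^+ n)%:E); last first.
  by rewrite EFinM lee_wpmul2l// fat_box_vol.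
move: up; rewrite -(fineK PBfin) -EFinM !lee_fin => up.
apply: fat_box_thin_bound => //; rewrite -(ler_pM2r (_ : 0 < eta / 4)%R) ?divr_gt0//.
apply: le_trans up _; rewrite /thin_level exprS addSn exprS invfM.
have : (0 <= 2 ^- (n + 4) * eta ^+ n * eta)%R.
  by rewrite !mulr_ge0 ?invr_ge0 ?exprn_ge0 ?ltW.
lra.
Qed.

End density_points.

(** * A dichotomy on the line *)

Section real_line.
Context {R : realType}.

Lemma right_limit_le (L : \bar R) (p : R -> R) r d : {for r, continuous p} -> r < d ->
  (forall t, r < t < d -> (L <= (p t)%:E)%E) -> (L <= (p r)%:E)%E.
Proof.
move=> cp rd h; apply/lee_addgt0Pr => e e0.
have pr : \forall t \near r^'+, p t < p r + e.
  have : p t @[t --> r^'+] --> p r by exact: cvg_at_right_filter.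
  by move=> /cvgr_lt; apply; rewrite ltrDl.
have ev : \forall t \near r^'+, p t < p r + e /\ r < t < d.
  apply: filterI; first exact: pr.
  apply: filterS2 (nbhs_right_gt r) (nbhs_right_lt rd) => t rt td.
  by apply/andP.
have [t [pt rt]] : exists t, p t < p r + e /\ r < t < d .
  by have := @filter_ex _ _ (at_right_proper_filter r) _ ev.
apply: le_trans (h t rt) _.
by rewrite -EFinD lee_fin ltW.
Qed.

(** Baire's theorem for a nonempty closed subset C of the line covered by countably
    many closed sets: one of them contains a whole portion of C.  Otherwise nested
    segments centred on C could be chosen so as to avoid the k-th set at step k. *)
Lemma baire_closed (C : set R) (F : nat -> set R) :
  closed C -> C !=set0 -> (forall k, closed (F k)) -> C `<=` \bigcup_k F k ->
  exists k u v, (exists x, C x /\ u < x < v) /\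
    (forall x, C x -> u < x < v -> F k x).
Proof.
move=> cC [c Cc] cF CF; apply: contrapT => no.
have step : forall q : nat * (R * R), exists s' : R * R,
    C q.2.1 /\ 0 < q.2.2 ->
    [/\ C s'.1, 0 < s'.2 <= q.2.2 / 2,
        q.2.1 - q.2.2 <= s'.1 - s'.2, s'.1 + s'.2 <= q.2.1 + q.2.2 &
        forall y, s'.1 - s'.2 <= y <= s'.1 + s'.2 -> ~ F q.1 y].
  move=> [k [x r]] /=.
  have [[Cx r0]|] := pselect (C x /\ 0 < r); last by move=> h; exists (x, r) => /h.
  have [x' [Cx' xx' nF]] : exists x', [/\ C x', x - r < x' < x + r & ~ F k x'].
    apply: contrapT => no'; apply: no; exists k, (x - r), (x + r); split.
      by exists x; split=> //; apply/andP; split; lra.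
    by move=> y Cy yr; apply: contrapT => nF; apply: no'; exists y.
  have : nbhs x' (~` F k) by apply: open_nbhs_nbhs; split=> //; exact/closed_openC.
  move=> /nbhs_ballP[e /= e0 he].
  exists (x', Num.min (e / 2) (Num.min (r / 2) (Num.min (x' - x + r) (x + r - x')))) => _ /=.
  case/andP: xx' => h1 h2.
  set m := Num.min _ _.
  have : m <= m by [].
  rewrite {2}/m !le_min => /and4P[m1 m2 m3 m4].
  have m0 : 0 < m by rewrite /m !lt_min; apply/and4P; split; lra.
  split => //; [apply/andP; split; lra|lra|lra|].
  move=> y /andP[y1 y2]; apply: he; rewrite /ball/= ltr_distlC; apply/andP; split; lra.
have [f hf] := choice step.
pose S := fix S k : R * R := if k is k'.+1 then f (k', S k') else (c, 1).
have SS k : C (S k).1 /\ 0 < (S k).2.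
  elim: k => [|k [h1 h2]]; first by split.
  by have [? /andP[? _] _ _ _] := hf (k, S k) (conj h1 h2).
have hS k := hf (k, S k) (SS k).
pose a k := (S k).1 - (S k).2; pose b k := (S k).1 + (S k).2.
have a_nd k l : (k <= l)%N -> a k <= a l.
  move=> /subnK <-; elim: (l - k)%N => [//|j]; rewrite addSn => /le_trans; apply.
  by have [] := hS (j + k)%N.
have b_ni k l : (k <= l)%N -> b l <= b k.
  move=> /subnK <-; elim: (l - k)%N => [//|j]; rewrite addSn; apply: le_trans.
  by have [] := hS (j + k)%N.
have ab k l : a k <= b l.
  apply: (@le_trans _ _ (a (maxn k l))); first by apply: a_nd; exact: leq_maxl.
  apply: (@le_trans _ _ (b (maxn k l))); last by apply: b_ni; exact: leq_maxr.
  by rewrite /a /b; have [_ h] := SS (maxn k l); lra.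
pose l := sup (range a).
have al k : a k <= l by apply: ub_le_sup; [exists (b 0%N) => _ [j _ <-]; exact: ab|exists k].
have lb k : l <= b k.
  by apply: ge_sup; [exists (a 0%N), 0%N|move=> _ [j _ <-]; exact: ab].
have rk k : (S k).2 <= 2 ^- k.
  elim: k => [|k IH]; first by rewrite expr0 invr1.
  have [_ /andP[_ h] _ _ _] := hS k; apply: le_trans h _.
  by rewrite exprS invfM mulrC ler_wpM2l.
have Cl : C l.
  apply: cC => V /nbhs_ballP[e /= e0 he].
  have [k hk] : exists k, 2 ^- k < e.
    exists (Num.bound e^-1); rewrite invf_plt ?posrE ?exprn_gt0//.
    apply: (lt_trans (archi_boundP _)); first by rewrite invr_ge0 ltW.
    by rewrite -natrX ltr_nat ltn_expl.
  exists (S k).1; split; first by have [] := SS k.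
  apply: he; rewrite /ball/= ltr_distl.
  have := al k; have := lb k; have := rk k; rewrite /a /b => *.
  by apply/andP; split; lra.
have [k _ Fl] := CF l Cl.
have [_ _ _ _ nF] := hS k; apply: (nF l) Fl.
by have := al k.+1; have := lb k.+1; rewrite /a /b => -> ->.
Qed.

(** The supremum of the points of C to the left of t: a gap of C opens there. *)
Lemma last_exit (C : set R) c t : closed C -> C c -> c < t -> ~ C t ->
  exists a, [/\ c <= a, a < t, C a & forall s, a < s <= t -> ~ C s].
Proof.
move=> cC Cc ct nCt.
pose S := C `&` [set x | x <= t].
have supS : has_sup S by split; [exists c; split=> //; exact: ltW|exists t => x []].
have Sa : S (sup S).
  have cS : closed S by apply: closedI => //; exact: closed_le.
  by apply: cS; apply: closure_sup; case: supS.
have ca : c <= sup S by apply: ub_le_sup; [case: supS|split=> //; exact: ltW].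
exists (sup S); split => //.
- rewrite lt_neqAle; case: (Sa) => _ -> /=; rewrite andbT.
  by apply/eqP => E; apply: nCt; rewrite -E; case: Sa.
- by case: Sa.
- move=> s /andP[h1 h2] Cs; have : s <= sup S by apply: ub_le_sup; [case: supS|].
  by rewrite leNgt h1.
Qed.

Lemma first_entry (C : set R) c t : closed C -> C c -> t < c -> ~ C t ->
  exists a, [/\ a <= c, t < a, C a & forall s, t <= s < a -> ~ C s].
Proof.
move=> cC Cc tc nCt.
have := @last_exit (-%R @^-1` C) (- c) (- t) _ _ _ _.
rewrite /= !opprK ltrN2 => -[].
- by apply: preimage_closed => // x _; exact: opp_continuous.
- by [].
- by [].
- by [].
move=> a [h1 h2 h3 h4]; exists (- a); split => //; [lra|lra|].
by move=> s hs Cs; apply: (h4 (- s)); [lra|rewrite /= opprK].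
Qed.

Lemma connected_side (I U V : set R) t : connected I -> open U -> open V ->
  U `&` V = set0 -> I `<=` U `|` V -> I t -> V t -> I `<=` V.
Proof.
move=> cI oU oV UV IUV It Vt.
have : I `&` V = I.
  apply: cI; first by exists t.
    by exists V.
  exists (~` U); first by exact: open_closedC.
  apply/seteqP; split=> x [Ix h]; split=> //.
    by move=> Ux; have : set0 x by rewrite -UV.
  by case: (IUV x Ix).
by move=> E x; rewrite -E => -[].
Qed.

Section dichotomy.
Variables (A B : set R) (FA FB : nat -> set R).
Hypotheses (cA : forall k, closed (FA k)) (cB : forall k, closed (FB k)).
Hypotheses (AB : forall t, A t \/ B t) (ABF : forall t, A t -> B t -> False).
Hypotheses (AF : A `<=` \bigcup_k FA k) (BF : B `<=` \bigcup_k FB k).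
Hypotheses (FAB : forall k t, FA k t -> ~ B t) (FBA : forall k t, FB k t -> ~ A t).
Let one_sided_free (F : nat -> set R) (X : set R) :=
  forall k a sg eta, (sg = 1 \/ sg = -1) -> 0 < eta -> F k a ->
    ~ (forall t, 0 < sg * (t - a) < eta -> X t).

(* The common frontier of A and B; if it is empty, the line is split into two
   disjoint open sets and connectedness concludes. *)
Let C := ~` (interior A `|` interior B).

(* On ]u, v[ all frontier points lie in F k, hence in Y.  A point t of X in this
   interval then is in a gap of the frontier that is contained in X, and the end
   of the gap nearest to c is in F k: this is excluded by [free].  So ]u, v[ lies
   in Y and c is interior to Y, a contradiction. *)
Let side (X Y : set R) (F : nat -> set R) k u v c :
  (forall t, X t \/ Y t) -> (forall t, X t -> Y t -> False) ->
  C = ~` (interior X `|` interior Y) ->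
  one_sided_free F X -> (forall k t, F k t -> ~ X t) ->
  C c -> u < c < v -> (forall x, C x -> u < x < v -> F k x) -> False.
Proof.
move=> XY XYF CE free FX Cc /andP[uc cv] CF.
have oX : open (interior X) by exact: open_interior.
have oY : open (interior Y) by exact: open_interior.
have XY0 : interior Y `&` interior X = set0.
  apply/seteqP; split=> // x [/interior_subset Yx /interior_subset Xx].
  exact: XYF Xx Yx.
have cC : closed C by rewrite CE; apply: open_closedC; exact: openU.
have notC x : ~ C x -> (interior Y `|` interior X) x.
  by rewrite CE => /contrapT[]; [right|left].
have JY t : u < t < v -> Y t.
  move=> /andP[ut tv].
  have [Ct|nCt] := pselect (C t).
    by have [Xt|//] := XY t; case: (FX k t) => //; apply: CF => //; rewrite ut.
  case: (notC _ nCt) => [/interior_subset//|Xt]; exfalso.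
  have [ct|tc|E] := ltgtP c t; last by apply: nCt; rewrite -E.
    have [a [ca at_ Ca Cs]] := last_exit cC Cc ct nCt.
    have Xs : `]a, t]%classic `<=` interior X.
      apply: (@connected_side _ (interior Y) _ t) => //.
      - exact/connected_intervalP/interval_is_interval.
      - by move=> s /=; rewrite in_itv/= => /Cs/notC.
      - by rewrite /= in_itv/= at_ lexx.
    apply: (free k a 1 (t - a)) => //; [by left|by rewrite subr_gt0|apply: CF => //; lra|].
    move=> s hs; apply: interior_subset; apply: Xs; rewrite /= in_itv/=; lra.
  have [a [ca at_ Ca Cs]] := first_entry cC Cc tc nCt.
  have Xs : `[t, a[%classic `<=` interior X.
    apply: (@connected_side _ (interior Y) _ t) => //.
    - exact/connected_intervalP/interval_is_interval.
    - by move=> s /=; rewrite in_itv/= => /Cs/notC.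
    - by rewrite /= in_itv/= at_ lexx.
  apply: (free k a (-1) (a - t)) => //; [by right|by rewrite subr_gt0|apply: CF => //; lra|].
  move=> s hs; apply: interior_subset; apply: Xs; rewrite /= in_itv/=; lra.
move: Cc; rewrite CE; apply; right.
have : nbhs c `]u, v[%classic by apply: near_in_itvoo; rewrite in_itv/= uc.
by apply: filterS => t; rewrite /= in_itv/=; exact: JY.
Qed.

(** If the line is the disjoint union of A and B, both covered by countably many
    closed sets disjoint from the other one, then it equals A or B, unless a segment
    contained in one of them ends at a point of a closed piece of the other.  By
    [baire_closed] one of the pieces contains a portion of the common frontier, and
    the gaps of the frontier near that portion provide such segments. *)
Lemma line_dichotomy : one_sided_free FB A -> one_sided_free FA B ->
  (forall t, A t) \/ (forall t, B t).
Proof.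
move=> freeA freeB.
have [[c Cc]|/forallNP C0] := pselect (C !=set0).
  exfalso.
  have cC : closed C by apply: open_closedC; apply: openU; exact: open_interior.
  pose F k := FA k `|` FB k.
  (* The two families of pieces are interleaved according to parity. *)
  have [|x Cx|k [u [v [[x [Cx ux]] h]]]] := @baire_closed C
    (fun k => if odd k then FA k./2 else FB k./2) cC (ex_intro _ c Cc).
  - by move=> k; case: ifP.
  - case: (AB x) => [/AF|/BF] [k _ Fx].
      by exists k.*2.+1 => //=; rewrite odd_double/= uphalf_double.
    by exists k.*2 => //; rewrite odd_double doubleK.
  move: h; case: ifP => _ h.
    apply: (side (X := B) (Y := A) (F := FA)) Cx ux h => //.
    - by move=> t; case: (AB t); [right|left].
    - by move=> t Bt At; exact: ABF At Bt.
    - by rewrite /C setUC.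
  exact: (side (X := A) (Y := B) (F := FB)) Cx ux h.
have cov : setT `<=` interior A `|` interior B by move=> t _; apply: contrapT; exact: C0.
have disj : interior A `&` interior B = set0.
  apply/seteqP; split=> // x [/interior_subset Ax /interior_subset Bx].
  exact: ABF Ax Bx.
have conn : connected [set: R] by exact/connected_intervalP.
case: (cov 0 I) => h0; [left|right] => t; apply: interior_subset.
  apply: (@connected_side _ (interior B) (interior A) 0 conn) => //; try exact: open_interior.
    by rewrite setIC.
  by rewrite setUC.
by apply: (@connected_side _ (interior A) (interior B) 0 conn) => //; exact: open_interior.
Qed.

End dichotomy.

End real_line.

(** * Sets whose essential boundary has null projections *)

Section rigidity.
Context {R : realType}.
Local Open Scope ereal_scope.

(** A cube centred at a nearby point and of a slightly larger size contains the
    given cube, and the bound eps r^n is continuous in r. *)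
Lemma thin_closed n (M : set 'rV[R]_n) eps dl : closed (thin M eps dl).
Proof.
move=> x xcl r /andP[r0 rd].
apply: (@right_limit_le _ _ (fun t => eps * t ^+ n)%R r dl) => //.
  apply: continuousM; first exact: cst_continuous.
  exact: exprn_continuous.
move=> t /andP[rt td].
have tr : (0 < t - r)%R by rewrite subr_gt0.
have [z [zt xz]] := xcl _ (nbhsx_ballx x (t - r)%R tr).
apply: le_trans (zt t _); last by rewrite (lt_trans r0 rt).
apply: le_leb_outer => y [My /cubeP cy]; split=> //; apply/cubeP => i.
have [_ /(_ ord0 i)] := xz; rewrite /ball/= ltr_distl => /andP[h1 h2].
by have /andP[h3 h4] := cy i; apply/andP; split; lra.
Qed.

Lemma insert_continuous n (i : 'I_n.+1) (p : 'rV[R]_n) :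
  continuous (fun t => insert i t p).
Proof.
move=> t V /nbhs_ballP[e /= e0 he]; apply/nbhs_ballP; exists e => //= s ts.
apply: he; split=> // a b; rewrite (ord1 a) !mxE.
by case: (unlift i b) => [k|//]; exact: ballxx.
Qed.

Variables (n : nat) (M : set 'rV[R]_n.+1).
Local Notation D0 := (density0 M).
Local Notation D1 := (density0 (~` M)).

(** For measurable M these are the points of the essential boundary; see
    [essential_boundaryE]. *)
Definition no_density : set 'rV[R]_n.+1 := ~` (D0 `|` D1).

Lemma density0_disjoint x : D0 x -> D1 x -> False.
Proof.
move=> d0 /(density0_thin (thin_level_gt0 n.+1))[k hk].
by apply: (thinC_density0 _ hk d0).
Qed.

(** A line parallel to the i-th axis is given by its projection.  It is bad if it
    meets the boundary or contains an end of a segment as in [one_sided], for M or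
    for its complement, in one of the two directions and at some scale
    1 / (k + 1). *)
Definition bad_lines (i : 'I_n.+1) : set 'rV[R]_n :=
  drop_coord i @` no_density `|`
  \bigcup_(kb : nat * bool) (drop_coord i @` one_sided M i ((-1) ^+ kb.2)%R kb.1.+1%:R^-1 `|`
                drop_coord i @` one_sided (~` M) i ((-1) ^+ kb.2)%R kb.1.+1%:R^-1).

Lemma sign_cases (b : bool) : ((-1) ^+ b = 1 :> R)%R \/ ((-1) ^+ b = -1 :> R)%R.
Proof. by case: b; rewrite ?expr0 ?expr1; [right|left]. Qed.

Lemma bad_lines_null i : leb_outer (drop_coord i @` no_density) = 0 ->
  leb_outer (bad_lines i) = 0.
Proof.
have U0 (X Y : set 'rV[R]_n) : leb_outer X = 0 -> leb_outer Y = 0 -> leb_outer (X `|` Y) = 0.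
  move=> X0 Y0; apply/eqP; rewrite eq_le leb_outer_ge0 andbT.
  by apply: le_trans (leb_outerU _ _) _; rewrite X0 Y0 adde0.
move=> h; apply: (U0) => //.
apply: (outer_bigcup_countable_null (mu := @leb_outer R n)) => -[k b].
by apply: U0; apply: one_sided_proj_null; rewrite ?invr_gt0//; exact: sign_cases.
Qed.

Lemma free_of_one_sided (M' : set 'rV[R]_n.+1) i p k a sg eta :
  (forall kb : nat * bool, ~ (drop_coord i @` one_sided M' i ((-1) ^+ kb.2)%R kb.1.+1%:R^-1) p) ->
  (sg = 1 \/ sg = - 1)%R -> (0 < eta)%R ->
  thin (~` M') (thin_level n.+1) k.+1%:R^-1 (insert i a p) ->
  ~ (forall t, (0 < sg * (t - a) < eta)%R -> density0 M' (insert i t p)).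
Proof.
move=> nos sg1 eta0 th all.
have [b sgE] : exists b : bool, sg = ((-1) ^+ b)%R.
  by case: sg1 => ->; [exists false|exists true].
pose j := maxn k (Num.bound eta^-1).
have jeta : (j.+1%:R^-1 <= eta)%R.
  rewrite invf_ple ?posrE//.
  apply: le_trans (ltW (archi_boundP _)) _; first by rewrite invr_ge0 ltW.
  by rewrite ler_nat ltnW// ltnS leq_maxr.
apply: (nos (j, b)); exists (insert i a p); last by rewrite insertK.
split.
  apply: thin_le th; rewrite lef_pV2 ?posrE// ler_nat ltnS; exact: leq_maxl.
move=> t; rewrite insert_at insertK -sgE => /andP[h1 h2]; apply: all.
by rewrite h1/=; exact: lt_le_trans jeta.
Qed.

(** [line_dichotomy] on the line: the closed pieces are the points that are thin
    below a scale 1 / (k + 1), and ends of segments are excluded by the definition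
    of bad lines. *)
Lemma good_line i p : ~ bad_lines i p ->
  (forall t, D0 (insert i t p)) \/ (forall t, D1 (insert i t p)).
Proof.
move=> /not_orP[nod nos].
have clo (M' : set 'rV[R]_n.+1) k :
    closed [set t | thin M' (thin_level n.+1) k.+1%:R^-1 (insert i t p)].
  apply: (@preimage_closed _ _ (fun t => insert i t p)); last exact: thin_closed.
  by move=> t _; exact: insert_continuous.
apply: (@line_dichotomy _ (fun t => D0 (insert i t p)) (fun t => D1 (insert i t p))
  (fun k t => thin M (thin_level n.+1) k.+1%:R^-1 (insert i t p))
  (fun k t => thin (~` M) (thin_level n.+1) k.+1%:R^-1 (insert i t p))).
- by move=> k; exact: clo.
- by move=> k; exact: clo.
- move=> t; apply: contrapT => /not_orP nD; apply: nod.
  exists (insert i t p); last by rewrite insertK.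
  by move=> [h|h]; case: nD.
- by move=> t; exact: density0_disjoint.
- by move=> t /(density0_thin (thin_level_gt0 n.+1))[k hk]; exists k.
- by move=> t /(density0_thin (thin_level_gt0 n.+1))[k hk]; exists k.
- move=> k t th d1.
  have th' : thin (~` ~` M) (thin_level n.+1) k.+1%:R^-1 (insert i t p) by rewrite setCK.
  by apply: (thinC_density0 _ th' d1); rewrite invr_gt0.
- move=> k t th d0.
  by apply: (thinC_density0 _ th d0); rewrite invr_gt0.
- move=> k a sg eta sg1 eta0 th; apply: free_of_one_sided (sg1) eta0 th => kb h.
  by apply: nos; exists kb => //; left.
- move=> k a sg eta sg1 eta0 th; apply: free_of_one_sided (sg1) eta0 _ => [kb h|].
    by apply: nos; exists kb => //; right.
  by rewrite setCK; exact: th.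
Qed.

(** Up to null sets, the points of M in the cube have density zero for the
    complement; on a good line all the other points then share this property, in
    particular the translates, which belong to M up to a null set. *)
Lemma translation_density i (c : R) x r :
  leb_outer (drop_coord i @` no_density) = 0 ->
  leb_outer (M `&` cube x r) <= leb_outer (M `&` cube (setcoord x i c) r).
Proof.
move=> /bad_lines_null Z; have {Z}Z0 := leb_outer_cylinder_null i Z.
set Z := drop_coord i @^-1` _ in Z0.
(* The translation carrying x to [setcoord x i c]. *)
pose v : 'rV[R]_n.+1 := ((c - x ord0 i) *: delta_mx ord0 i)%R.
have vE j : v ord0 j = if j == i then (c - x ord0 i)%R else 0%R.
  by rewrite !mxE eqxx /=; case: eqP => _; rewrite ?mulr1 ?mulr0.
pose G := D1 `&` cube x r `\` Z.
apply: (@le_trans _ _ (leb_outer Z + (leb_outer (M `&` D0) + leb_outer G))).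
  apply: (@le_trans _ _ (leb_outer (Z `|` (M `&` D0 `|` G)))).
    apply: le_leb_outer => z [Mz cz].
    have [Zz|nZ] := pselect (Z z); [by left|right].
    have [D0z|nD0] := pselect (D0 z); [by left|right].
    split=> //; split=> //; apply: contrapT => nD1; apply: nZ; left.
    by exists z => // -[].
  apply: le_trans (leb_outerU _ _) _; apply: leeD => //; exact: leb_outerU.
rewrite Z0 density0_null !add0e -(leb_outer_translate v G).
apply: (@le_trans _ _ (leb_outer (~` M `&` D1) + leb_outer (M `&` cube (setcoord x i c) r))).
  apply: le_trans (leb_outerU _ _); apply: le_leb_outer => _ [z [[D1z cz] nZ] <-].
  have zE t : insert i t (drop_coord i z) = setcoord z i t.
    apply/rowP => j; rewrite setcoordE; case: (unliftP i j) => [k ->|->].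
      by rewrite insert_lift drop_coordE eq_sym (negPf (neq_lift _ _)).
    by rewrite insert_at eqxx.
  have D1zv : D1 (z + v)%R.
    case: (good_line nZ) => all.
      by have := all (z ord0 i); rewrite drop_coordK => /density0_disjoint/(_ D1z).
    have := all (z ord0 i + (c - x ord0 i))%R; rewrite zE.
    congr (density0 _ _); apply/rowP => j; rewrite setcoordE [in RHS]mxE vE.
    by case: eqP => [->|_]; rewrite ?addr0.
  have [Mzv|nM] := pselect (M (z + v)%R); [right|by left].
  split=> //; apply/cubeP => j; move/cubeP: cz => /(_ j).
  rewrite setcoordE mxE vE; case: eqP => [->|_] /andP[h1 h2]; apply/andP; split; lra.
by rewrite density0_null add0e.
Qed.

Lemma density0_setcoord i (c : R) x :
  leb_outer (drop_coord i @` no_density) = 0 -> D0 (setcoord x i c) -> D0 x.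
Proof.
move=> Z0 d0 eps /d0[dl dl0 th]; exists dl => // r hr.
by apply: le_trans (th r hr); exact: translation_density.
Qed.

(** Change the coordinates of x into those of y one at a time. *)
Lemma density0_everywhere x y :
  (forall i, leb_outer (drop_coord i @` no_density) = 0) -> D0 x -> D0 y.
Proof.
move=> Z0 d0.
pose z (k : nat) : 'rV[R]_n.+1 := \row_j (if (j < k)%N then y ord0 j else x ord0 j).
have zk k : (k <= n.+1)%N -> D0 (z k).
  elim: k => [|k IH] kn.
    by rewrite (_ : z 0%N = x)//; apply/rowP => j; rewrite mxE.
  apply: (@density0_setcoord (Ordinal kn) (x ord0 (Ordinal kn))) => //.
  rewrite (_ : setcoord _ _ _ = z k); first by apply: IH; exact: ltnW.
  apply/rowP => j; rewrite setcoordE !mxE; case: eqP => [->/=|/eqP jk].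
    by rewrite ltnn.
  rewrite ltnS leq_eqVlt; case: eqP => //= E.
  by move: jk; rewrite -val_eqE /= E eqxx.
rewrite (_ : y = z n.+1); first exact: zk.
by apply/rowP => j; rewrite mxE ltn_ord.
Qed.

End rigidity.

(** If some point has density zero for M or for its complement, then all points do
    and [density0_null] applies.  Otherwise all points are boundary points, and the
    projections of the boundary are not null. *)
Lemma null_boundary_trivial {R : realType} n (M : set 'rV[R]_n.+1) :
  (forall i, leb_outer (drop_coord i @` no_density M) = 0%E) ->
  leb_outer M = 0%E \/ leb_outer (~` M) = 0%E.
Proof.
move=> Z0.
have [[x d0]|/forallNP n0] := pselect (exists x, density0 M x).
  left; rewrite -(density0_null M) setIidl// => y _.
  exact: (@density0_everywhere _ _ M x y).
have Z1 i : leb_outer (drop_coord i @` no_density (~` M)) = 0%E.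
  by rewrite /no_density setCK setUC; exact: Z0.
have [[x d1]|/forallNP n1] := pselect (exists x, density0 (~` M) x).
  right; rewrite -(density0_null (~` M)) setIidl// => y _.
  exact: (@density0_everywhere _ _ (~` M) x y).
have := Z0 ord0; rewrite (_ : _ @` _ = setT); last first.
  apply/seteqP; split=> // p _; exists (insert ord0 0 p); last by rewrite insertK.
  by move=> [/n0|/n1].
move=> T0; exfalso.
have := leb_outer_null_sub (subsetT (cube (0 : 'rV[R]_n) 1)) T0.
rewrite leb_outer_cube// => -[] /eqP; rewrite expf_eq0 => /andP[_].
by rewrite mulr1 pnatr_eq0.
Qed.

(** * The Euclidean norm and the Hausdorff measure *)

Section enorm_facts.
Context {R : realType}.
Implicit Types m : nat.

Lemma coord_le_enorm m (x : 'rV[R]_m) i : `|x ord0 i| <= enorm x.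
Proof.
rewrite -sqrtr_sqr /enorm ler_sqrt; last by apply: sumr_ge0 => j _; exact: sqr_ge0.
by rewrite (bigD1 i)//= lerDl; apply: sumr_ge0 => j _; exact: sqr_ge0.
Qed.

Lemma enorm_le m (x : 'rV[R]_m) s : 0 <= s -> (forall i, `|x ord0 i| <= s) ->
  enorm x <= m%:R * s.
Proof.
move=> s0 h; rewrite -[leRHS]ger0_norm ?mulr_ge0// -sqrtr_sqr.
rewrite /enorm ler_sqrt ?sqr_ge0//.
apply: (@le_trans _ _ (\sum_(i < m) s ^+ 2)).
  by apply: ler_sum => i _; rewrite -(real_normK (num_real _)) lerXn2r ?nnegrE//.
rewrite sumr_const card_ord exprMn -[leLHS]mulr_natl ler_wpM2r ?sqr_ge0//.
by rewrite -natrX ler_nat; case: m {x h} => // m; rewrite expnS expn1 leq_pmulr.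
Qed.

End enorm_facts.

Lemma nneseries_le_bound {R : realType} (u : nat -> \bar R) (c : \bar R) :
  (forall i, 0 <= u i)%E -> (forall K, \sum_(i < K) u i <= c)%E ->
  (\sum_(i <oo) u i <= c)%E.
Proof.
move=> u0 h; apply: lime_le; first by apply: is_cvg_nneseries => i _ _; exact: u0.
by apply: nearW => K; rewrite big_mkord.
Qed.

Section hausdorff_borel.
Context {R : realType}.
Local Open Scope ereal_scope.
Variables (k n : nat).
Local Notation H := (@hausdorff_outer R k n).
Local Notation Hp := (@hausdorff_pre R k n).
Implicit Types A B X : set 'rV[R]_n.

Lemma hausdorff_pre_le delta X : (0 < delta)%R -> Hp delta X <= H X.
Proof. by move=> d0; apply: ereal_sup_ubound; exists delta. Qed.

Lemma hausdorff_pre_le_cover delta X F :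
  covers (fun A : small_set n delta => sval A) X F ->
  Hp delta X <= \sum_(j <oo) oapp (@hausdorff_weight R k n delta) 0 (F j).
Proof. exact: cover_outer_le. Qed.

Lemma hausdorff_mono A B : A `<=` B -> H A <= H B.
Proof. exact: le_hausdorff_outer. Qed.

Lemma hausdorff_pre_ge0 delta X : 0 <= Hp delta X.
Proof. exact/cover_outer_ge0/hausdorff_weight_ge0. Qed.

Lemma hausdorff_pre_anti d1 d2 X : (d1 <= d2)%R -> Hp d2 X <= Hp d1 X.
Proof.
move=> d12; apply: le_ereal_inf_tmp => _ [F XF <-].
have w (A : small_set (R := R) n d1) : sval A !=set0 /\ ediam (sval A) <= d2%:E.
  by case: (svalP A) => A0 Ad; split=> //; apply: le_trans Ad _; rewrite lee_fin.
pose G j : option (small_set n d2) :=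
  omap (fun A : small_set n d1 => exist _ (sval A) (w A)) (F j).
apply: le_trans (hausdorff_pre_le_cover (F := G) _) _.
  by move=> x /XF[j _ Fx]; exists j => //; rewrite /G; move: Fx; case: (F j).
by rewrite le_eqVlt; apply/orP; left; apply/eqP/eq_eseriesr => j _; rewrite /G; case: (F j).
Qed.

Lemma enorm_le_ediam A x y : A x -> A y -> (enorm (x - y))%:E <= ediam A.
Proof. by move=> Ax Ay; apply: ereal_sup_ubound; exists (x, y). Qed.

(** A set of diameter at most delta cannot meet both A and B, so that a cover of the
    union splits into a cover of A and a cover of B. *)
Lemma hausdorff_pre_separated delta s A B : (delta < s)%R ->
  (forall x y, A x -> B y -> (s <= enorm (x - y))%R) ->
  Hp delta A + Hp delta B <= Hp delta (A `|` B).
Proof.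
move=> ds sep; apply: le_ereal_inf_tmp => _ [F XF <-].
pose G (Y : set 'rV[R]_n) j : option (small_set n delta) :=
  obind (fun E => if `[< (sval E `&` Y) !=set0 >] then Some E else None) (F j).
have G0 Y j : 0 <= oapp (@hausdorff_weight R k n delta) 0 (G Y j).
  by case: (G Y j) => //= ?; exact: hausdorff_weight_ge0.
have cG Y : Y `<=` A `|` B -> covers (fun E : small_set n delta => sval E) Y (G Y).
  move=> YAB x Yx; have [j _ Fx] := XF x (YAB x Yx); exists j => //; rewrite /G.
  by move: Fx; case: (F j) => //= E Ex; rewrite asboolT//; exists x.
apply: le_trans (leeD (hausdorff_pre_le_cover (cG A (@subsetUl _ _ _)))
                      (hausdorff_pre_le_cover (cG B (@subsetUr _ _ _)))) _.
rewrite -nneseriesD//; apply: lee_nneseries => j _; first by move=> _; rewrite adde_ge0.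
rewrite /G; case: (F j) => [E|] /=; last by rewrite adde0.
case: asboolP => [[x [Ex Ax]]|_]; case: asboolP => [[y [Ey By]]|_] /=; rewrite ?adde0 ?add0e//.
- have := le_trans (enorm_le_ediam Ex Ey) (svalP E).2; rewrite lee_fin.
  by move=> /(le_trans (sep _ _ Ax By)); rewrite leNgt ds.
- exact: hausdorff_weight_ge0.
Qed.

Lemma hausdorff_separated s A B : (0 < s)%R ->
  (forall x y, A x -> B y -> (s <= enorm (x - y))%R) ->
  H A + H B <= H (A `|` B).
Proof.
move=> s0 sep.
have [->|Hfin] := eqVneq (H (A `|` B)) +oo; first by rewrite leey.
have fin Y : Y `<=` A `|` B -> H Y \is a fin_num.
  move=> YAB; rewrite ge0_fin_numE ?hausdorff_outer_ge0//.
  by apply: (le_lt_trans (hausdorff_mono YAB)); rewrite ltey.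
apply/lee_addgt0Pr => e e0.
have e20 : (0 < e / 2)%R by rewrite divr_gt0.
have [_ [d1 /= d10 <-] h1] := ub_ereal_sup_adherent e20 (fin A (@subsetUl _ _ _)).
have [_ [d2 /= d20 <-] h2] := ub_ereal_sup_adherent e20 (fin B (@subsetUr _ _ _)).
pose d := (Num.min (Num.min d1 d2) (s / 2))%R.
have d0 : (0 < d)%R by rewrite /d !lt_min d10 d20 divr_gt0.
have [dd1 dd2] : (d <= d1 /\ d <= d2)%R by rewrite /d !ge_min !lexx !orbT.
have ds : (d < s)%R.
  by have : (d <= s / 2)%R; [rewrite /d ge_min lexx orbT|lra].
have l1 : H A <= Hp d1 A + (e / 2)%:E by rewrite -leeBlDr//; exact: ltW h1.
have l2 : H B <= Hp d2 B + (e / 2)%:E by rewrite -leeBlDr//; exact: ltW h2.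
apply: (le_trans (leeD l1 l2)).
rewrite addeACA -EFinD -splitr leeD2r//.
apply: le_trans (hausdorff_pre_le _ d0).
apply: le_trans (hausdorff_pre_separated ds sep).
by apply: leeD; exact: hausdorff_pre_anti.
Qed.

(** Caratheodory's criterion.  The part of X in the open half-space is exhausted by
    the parts B m at distance 1 / (m + 1) from the hyperplane, which are separated
    from the closed half-space.  The strips S m between consecutive B m
    are separated when their indices differ by two, so that their measures sum to a
    finite number and the strips beyond m contribute little. *)
Lemma hausdorff_halfspace i c : (H : set _ -> \bar R).-caratheodory (halfspace i c).
Proof.
apply: le_caratheodory_measurable => X.
change (H (X `&` halfspace i c) + H (X `&` ~` halfspace i c) <= H X).
have [->|Xfin] := eqVneq (H X) +oo; first by rewrite leey.
have fin Y : Y `<=` X -> H Y \is a fin_num.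
  move=> YX; rewrite ge0_fin_numE ?hausdorff_outer_ge0//.
  by apply: (le_lt_trans (hausdorff_mono YX)); rewrite ltey.
pose a (m : nat) : R := m.+1%:R^-1%R.
have a_dec m : (a m.+1 < a m)%R by rewrite /a ltf_pV2 ?posrE// ltr_nat.
pose B m := X `&` [set x | (c + a m < x ord0 i)%R].
pose S m := X `&` [set x | (c + a m.+1 < x ord0 i <= c + a m)%R].
set A := X `&` halfspace i c.
have BX m : B m `<=` X by move=> x [].
have SX m : S m `<=` X by move=> x [].
pose phi m := fine (H (B m)); pose h m := fine (H (S m)).
have phiE m : H (B m) = (phi m)%:E by rewrite fineK// fin.
have hE m : H (S m) = (h m)%:E by rewrite fineK// fin.
have coordsep (u v : R) (U V : set 'rV[R]_n) : (u < v)%R ->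
    (forall x, U x -> (x ord0 i <= u)%R) -> (forall x, V x -> (v < x ord0 i)%R) ->
    H U + H V <= H (U `|` V).
  move=> uv hU hV; apply: (@hausdorff_separated (v - u)%R); first by rewrite subr_gt0.
  move=> x y /hU xu /hV yv; apply: le_trans (coord_le_enorm _ i).
  by rewrite !mxE distrC ger0_norm; lra.
have HAB m : H A + H (B m) <= H X.
  apply: (@le_trans _ _ (H (A `|` B m))).
    apply: (@coordsep c (c + a m)%R); first by rewrite ltrDl invr_gt0.
    - by move=> x [].
    - by move=> x [].
  by apply: hausdorff_mono => x [[]|[]].
have Hstrip m : (h m.+1 + phi m <= phi m.+2)%R.
  rewrite -lee_fin EFinD -hE -!phiE.
  apply: (@le_trans _ _ (H (S m.+1 `|` B m))).
    apply: (@coordsep (c + a m.+1)%R (c + a m)%R); first by rewrite ltrD2l.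
    - by move=> x [_ /andP[]].
    - by move=> x [].
  have a1 := a_dec m; have a2 := a_dec m.+1.
  by apply: hausdorff_mono => x [[Xx /andP[h1 _]]|[Xx /= h1]]; split=> //=; lra.
have phi_nd : {homo phi : m p / (m <= p)%N >-> (m <= p)%R}.
  apply: homo_leq; [exact: lexx|exact: le_trans|move=> m].
  rewrite -lee_fin -!phiE; apply: hausdorff_mono => x [Xx /= h1]; split=> //=.
  by have := a_dec m; lra.
pose L := sup (range phi).
have HAfin : H A \is a fin_num by apply: fin => x [].
have phiub : has_ubound (range phi).
  exists (fine (H X)) => _ [m _ <-]; rewrite -lee_fin -phiE fineK; last exact: fin.
  exact: hausdorff_mono.
have phiL m : (phi m <= L)%R by apply: ub_le_sup => //; exists m.
have HAL : H A + L%:E <= H X.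
  rewrite -(fineK HAfin) -(fineK (fin X (@subset_refl _ _))) -EFinD lee_fin -lerBrDl.
  apply: ge_sup; first by exists (phi 0%N), 0%N.
  move=> _ [m _ <-]; rewrite lerBrDl -lee_fin EFinD fineK// -phiE fineK//.
  exact: fin.
apply/lee_addgt0Pr => e e0.
have [_ [m _ <-] me] : exists2 y, range phi y & (L - e / 2 < y)%R.
  by apply: sup_adherent; [rewrite divr_gt0|split=> //; exists (phi 0%N), 0%N].
suff HB : H (X `&` ~` halfspace i c) <= (L + e)%:E.
  apply: (le_trans (leeD2l _ HB)); rewrite EFinD addeA; exact: leeD2r.
apply: (@le_trans _ _ (H (B m.+1 `|` \bigcup_j S (m + j).+1))).
  apply: hausdorff_mono => x [Xx /negP]; rewrite -ltNge => cx.
  have [Bx|nB] := pselect (B m.+1 x); [by left|right].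
  have ex : exists p, (c + a p < x ord0 i)%R.
    exists (Num.bound (x ord0 i - c)^-1); rewrite -ltrBrDl /a invf_plt ?posrE ?subr_gt0//.
    apply: (lt_trans (archi_boundP _)); first by rewrite invr_ge0 subr_ge0 ltW.
    by rewrite ltr_nat.
  case: (ex_minnP ex) => p hp pmin.
  have mp : (m.+1 < p)%N.
    rewrite ltnNge; apply/negP => pm; apply: nB; split=> //=.
    apply: le_lt_trans hp; rewrite lerD2l /a lef_pV2 ?posrE// ler_nat ltnS.
    exact: pm.
  move: hp pmin; rewrite -(subnKC mp) => hp pmin.
  exists (p - m.+2)%N => //; split=> //=; rewrite hp/= leNgt; apply/negP => /pmin.
  by rewrite ltnn.
apply: (le_trans (outer_measureU2 (H : {outer_measure set _ -> \bar R}) _ _)).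
rewrite -[X in X + _]/(H (B m.+1)) phiE.
apply: (@le_trans _ _ ((phi m.+1)%:E + (2 * (L - phi m))%:E)).
  apply: leeD2l.
  apply: (le_trans (outer_measure_sigma_subadditive (H : {outer_measure set _ -> \bar R}) _)).
  apply: nneseries_le_bound => [j|K]; first exact: outer_measure_ge0.
  rewrite (eq_bigr (fun j : 'I_K => (h (m + j).+1)%:E)); last by move=> j _; exact: hE.
  rewrite sumEFin lee_fin.
  (* Two consecutive terms on either side, because each strip increases phi only
     two steps later. *)
  have tel : (\sum_(j < K) h (m + j).+1 + phi m + phi m.+1 <= phi (m + K)%N + phi (m + K).+1)%R.
    elim: K => [|K IH]; first by rewrite big_ord0 add0r addn0.
    rewrite big_ord_recr/= addnS; have := Hstrip (m + K)%N; lra.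
  have := phiL (m + K)%N; have := phiL (m + K).+1; have := phi_nd m m.+1 (leqnSn _); lra.
rewrite -EFinD lee_fin; have := phiL m.+1; lra.
Qed.

End hausdorff_borel.

(** * Densities, projections and sets of zero weighted perimeter *)

Section balls.
Context {R : realType}.
Local Open Scope ereal_scope.
Implicit Types n : nat.

Lemma eball_sub_cube n (x : 'rV[R]_n) r : eball x r `<=` cube x r.
Proof.
move=> y xy; apply/cubeP => i; have := le_lt_trans (coord_le_enorm _ i) xy.
rewrite !mxE ltr_norml => /andP[h1 h2]; apply/andP; split; lra.
Qed.

Lemma cube_sub_eball n (x : 'rV[R]_n) s : (0 < s)%R ->
  cube x s `<=` eball x (n.+1%:R * s).
Proof.
move=> s0 y /cubeP cy; rewrite /eball/=.
apply: (@le_lt_trans _ _ (n%:R * s)%R); last by rewrite ltr_pM2r// ltr_nat.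
apply: enorm_le; first exact: ltW.
by move=> i; have /andP[h1 h2] := cy i; rewrite !mxE ler_norml; apply/andP; split; lra.
Qed.

Lemma leb_outer_eball_bounds n (x : 'rV[R]_n) r : (0 < r)%R ->
  ((2 * (r / n.+1%:R)) ^+ n)%:E <= leb_outer (eball x r) <= ((2 * r) ^+ n)%:E.
Proof.
move=> r0; have rn : (0 < r / n.+1%:R)%R by rewrite divr_gt0.
rewrite -(leb_outer_cube x (ltW rn)) -(leb_outer_cube x (ltW r0)).
rewrite !le_leb_outer//; first exact: eball_sub_cube.
by move=> y /(cube_sub_eball rn); rewrite mulrCA mulfV// mulr1.
Qed.

Lemma leb_outer_eball_fin n (x : 'rV[R]_n) r : (0 < r)%R ->
  leb_outer (eball x r) \is a fin_num.
Proof.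
move=> r0; rewrite ge0_fin_numE ?leb_outer_ge0//.
by have /andP[_ /le_lt_trans] := leb_outer_eball_bounds x r0; apply; rewrite ltry.
Qed.

Lemma leb_outer_eball_gt0 n (x : 'rV[R]_n) r : (0 < r)%R ->
  (0 < fine (leb_outer (eball x r)))%R.
Proof.
move=> r0; have /andP[h _] := leb_outer_eball_bounds x r0.
have : ((2 * (r / n.+1%:R)) ^+ n)%:E <= (fine (leb_outer (eball x r)))%:E.
  by rewrite fineK// leb_outer_eball_fin.
by rewrite lee_fin; apply: lt_le_trans; rewrite exprn_gt0// mulr_gt0// divr_gt0.
Qed.

Lemma unit_ball_vol_gt0 n : (0 < @unit_ball_vol R n)%R.
Proof. exact: leb_outer_eball_gt0. Qed.

(** A projection does not increase the diameter, and a set of diameter D lies in a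
    cube of side slightly more than 2 D. *)
Lemma projection_small_set n delta (i : 'I_n.+1) (A : small_set (R := R) n.+1 delta) :
  leb_outer (drop_coord i @` sval A) <=
  (4 ^+ n / @unit_ball_vol R n)%:E * hausdorff_weight n A.
Proof.
case: A => A [[a Aa] Ad] /=; rewrite /hausdorff_weight /=.
set D := fine (ediam A).
have Afin : ediam A \is a fin_num.
  rewrite ge0_fin_numE; last by apply: ediam_ge0; exists a.
  by apply: le_lt_trans Ad _; rewrite ltry.
have D0 : (0 <= D)%R by apply: fine_ge0; apply: ediam_ge0; exists a.
rewrite -EFinM (_ : (4 ^+ n / _ * (_ * _))%R = (2 * D) ^+ n)%R; last first.
  rewrite mulrA divfK ?gt_eqF ?unit_ball_vol_gt0// -exprMn; congr (_ ^+ _)%R.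
  by field.
apply: (@right_limit_le _ _ (fun t => (2 * t) ^+ n)%R D (D + 1)%R); last 2 first.
- by rewrite ltrDl.
- move=> t /andP[Dt _]; rewrite -(leb_outer_cube (drop_coord i a)); last first.
    exact: ltW (le_lt_trans D0 Dt).
  apply: le_leb_outer => _ [x Ax <-]; apply/cubeP => j; rewrite !drop_coordE.
  have := enorm_le_ediam Ax Aa; rewrite -(fineK Afin) lee_fin -/D => h.
  have := le_trans (coord_le_enorm _ (lift i j)) h.
  by rewrite !mxE ler_norml => /andP[h1 h2]; apply/andP; split; lra.
apply: (@continuous_comp _ _ _ (fun t : R => 2 * t)%R (fun t => t ^+ n)%R).
  exact: mulrl_continuous.
exact: exprn_continuous.
Qed.

Lemma projection_null n (i : 'I_n.+1) (X : set 'rV[R]_n.+1) :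
  hausdorff_outer n X = 0 -> leb_outer (drop_coord i @` X) = 0.
Proof.
move=> X0; set C := (4 ^+ n / @unit_ball_vol R n)%R.
have C0 : (0 < C)%R by rewrite divr_gt0 ?unit_ball_vol_gt0 ?exprn_gt0.
apply/eqP; rewrite eq_le leb_outer_ge0 andbT; apply/lee_addgt0Pr => e e0.
rewrite add0e.
have : hausdorff_pre n 1 X < (e / C)%:E.
  apply: (@le_lt_trans _ _ 0); last by rewrite lte_fin divr_gt0.
  by rewrite -X0; exact: hausdorff_pre_le.
move=> /cover_outer_lt[F XF lt].
apply: (@le_trans _ _ (leb_outer (\bigcup_j (drop_coord i @` oapp sval set0 (F j))))).
  apply: le_leb_outer => _ [x /XF[j _ Fx] <-]; exists j => //; by exists x.
apply: le_trans (outer_measure_sigma_subadditive (@leb_outer R n) _) _.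
apply: (@le_trans _ _ (\sum_(j <oo) (C%:E * oapp (@hausdorff_weight R n n.+1 1) 0 (F j)))).
  apply: lee_nneseries => j _; first by move=> _; exact: leb_outer_ge0.
  case: (F j) => [A|] /=; first exact: projection_small_set.
  by rewrite image_set0 (outer_measure0 (@leb_outer R n)) mule0.
rewrite nneseriesZl; last first.
  by move=> j _; case: (F j) => //= ?; exact: hausdorff_weight_ge0.
rewrite -lee_pdivlMl//; apply: le_trans (ltW lt) _.
by rewrite -EFinM lee_fin mulrC.
Qed.

Definition density_ratio n (M : set 'rV[R]_n) x (r : R) : R :=
  (fine (leb n (M `&` eball x r)) / fine (leb n (eball x r)))%R.

Lemma leb_outer_sub_fin n (M : set 'rV[R]_n) x r : (0 < r)%R ->
  leb_outer (M `&` eball x r) \is a fin_num.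
Proof.
move=> r0; rewrite ge0_fin_numE ?leb_outer_ge0//.
apply: le_lt_trans (le_leb_outer (@subIsetr _ _ _)) _.
by rewrite -ge0_fin_numE ?leb_outer_ge0// leb_outer_eball_fin.
Qed.

Lemma density_ratio_ge0 n (M : set 'rV[R]_n) x r : (0 <= density_ratio M x r)%R.
Proof. by rewrite divr_ge0// fine_ge0// leb_outer_ge0. Qed.

(** The two ratios add up to one, by measurability of M. *)
Lemma density_ratioC n (M : set 'rV[R]_n) x r : leb_measurable M -> (0 < r)%R ->
  (density_ratio M x r = 1 - density_ratio (~` M) x r)%R.
Proof.
move=> mM r0.
have E : (fine (leb n (M `&` eball x r)) + fine (leb n (~` M `&` eball x r)) =
    fine (leb n (eball x r)))%R.
  rewrite -fineD ?leb_outer_sub_fin//; congr fine.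
  by rewrite [leb n (eball x r)]mM ![_ `&` eball x r]setIC.
have p : (0 < fine (leb n (eball x r)))%R by exact: leb_outer_eball_gt0.
by rewrite /density_ratio; rewrite -E in p *; field; rewrite gt_eqF.
Qed.

(** Balls and cubes of comparable sizes contain each other, at the cost of factors
    that depend on the dimension only. *)
Lemma has_density0P n (M : set 'rV[R]_n) x : has_density M x 0%R <-> density0 M x.
Proof.
split=> [/cvgr0_norm_lt h eps eps0|h].
  pose K : R := (2 * n.+1%:R)%R; have K0 : (0 < K)%R by rewrite mulr_gt0.
  have /h : (0 < eps / K ^+ n)%R by rewrite divr_gt0// exprn_gt0.
  rewrite near_withinE => /nbhs_ballP[dl /= dl0 hdl].
  exists (dl / n.+1%:R)%R; first exact: divr_gt0.
  move=> r /andP[r0 rdl].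
  have s0 : (0 < n.+1%:R * r)%R by rewrite mulr_gt0.
  apply: (@le_trans _ _ (leb_outer (M `&` eball x (n.+1%:R * r)))).
    by apply: le_leb_outer; apply: setIS; exact: cube_sub_eball.
  have := hdl (n.+1%:R * r)%R; rewrite /ball/= sub0r normrN gtr0_norm//.
  rewrite mulrC -ltr_pdivlMr// rdl mulrC => /(_ isT s0).
  rewrite -/(density_ratio M x (n.+1%:R * r)).
  rewrite ger0_norm ?density_ratio_ge0// /density_ratio ltr_pdivrMr ?leb_outer_eball_gt0// => lt.
  rewrite -(fineK (leb_outer_sub_fin _ _ s0)) lee_fin; apply: le_trans (ltW lt) _.
  have /andP[_ hb] := leb_outer_eball_bounds x s0.
  rewrite -(fineK (leb_outer_eball_fin x s0)) lee_fin in hb.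
  apply: le_trans (_ : eps / K ^+ n * (2 * (n.+1%:R * r)) ^+ n <= _)%R.
    by rewrite ler_wpM2l// divr_ge0 ?ltW// exprn_gt0.
  have -> : (2 * (n.+1%:R * r) = K * r)%R by rewrite mulrA.
  by clearbody K; rewrite exprMn mulrA divfK// gt_eqF// exprn_gt0.
apply/cvgr0Pnorm_le => e e0.
pose K : R := (n.+1%:R / 2)%R; have K0 : (0 < K)%R by rewrite divr_gt0.
have /h[dl dl0 th] : (0 < e / K ^+ n)%R by rewrite divr_gt0// exprn_gt0.
have ev : \forall r \near 0^'+, (0 < r < dl)%R.
  apply: filterS2 (nbhs_right_gt 0%R) (nbhs_right_lt dl0) => r r0 rd.
  by rewrite r0.
apply: filterS ev => r rdl; have /andP[r0 _] := rdl.
change (`|density_ratio M x r| <= e)%R; rewrite ger0_norm ?density_ratio_ge0//.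
rewrite /density_ratio ler_pdivrMr ?leb_outer_eball_gt0//.
have hM : leb_outer (M `&` eball x r) <= (e / K ^+ n * r ^+ n)%:E.
  by apply: le_trans (th r rdl); apply: le_leb_outer; apply: setIS; exact: eball_sub_cube.
rewrite -(fineK (leb_outer_sub_fin _ _ r0)) lee_fin in hM.
apply: le_trans hM _; rewrite -mulrA ler_wpM2l ?(ltW e0)//.
have /andP[hb _] := leb_outer_eball_bounds x r0.
rewrite -(fineK (leb_outer_eball_fin x r0)) lee_fin in hb.
apply: le_trans hb; rewrite -exprVn -exprMn le_eqVlt; apply/orP; left; apply/eqP.
by congr (_ ^+ _)%R; rewrite /K; field.
Qed.

Lemma has_density1P n (M : set 'rV[R]_n) x : leb_measurable M ->
  has_density M x 1%R <-> density0 (~` M) x.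
Proof.
move=> mM; rewrite -has_density0P.
have E : \forall r \near 0^'+, (density_ratio M x r = 1 - density_ratio (~` M) x r)%R.
  by apply: filterS (nbhs_right_gt 0%R) => r r0; exact: density_ratioC.
have E' : \forall r \near 0^'+, (density_ratio (~` M) x r = 1 - density_ratio M x r)%R.
  by apply: filterS E => r ->; rewrite subKr.
split=> h.
  have h2 : (1 - density_ratio M x r)%R @[r --> 0^'+] --> (1 - 1 : R)%R.
    by apply: cvgB h; exact: cvg_cst.
  rewrite subrr in h2; apply: cvg_trans h2; apply: near_eq_cvg.
  by apply: filterS E' => r h'; exact: esym h'.
have h2 : (1 - density_ratio (~` M) x r)%R @[r --> 0^'+] --> (1 - 0 : R)%R.
  by apply: cvgB h; exact: cvg_cst.
rewrite subr0 in h2; apply: cvg_trans h2; apply: near_eq_cvg.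
by apply: filterS E => r h'; exact: esym h'.
Qed.

Lemma essential_boundaryE n (M : set 'rV[R]_n.+1) : leb_measurable M ->
  essential_boundary M = no_density M.
Proof.
move=> mM; apply/seteqP; split=> x; rewrite /essential_boundary /no_density /=.
  by move=> [h0 h1] [d0|d1]; [apply: h0; apply/has_density0P|apply: h1; apply/has_density1P].
move=> h; split=> hd; apply: h; first by left; apply/has_density0P.
by right; apply/has_density1P.
Qed.

Section density_borel.
Variables (n : nat) (mu : {outer_measure set 'rV[R]_n -> \bar R}).
Hypothesis mhalf : forall i c, mu.-caratheodory (halfspace i c).
Local Notation T := (caratheodory_type mu).

Lemma cara_density0 M : measurable (density0 M : set T).
Proof.
have -> : density0 M = \bigcap_m \bigcup_k thin M (m.+1%:R^-1) k.+1%:R^-1.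
  apply/seteqP; split=> x h.
    move=> m _; have m0 : (0 < m.+1%:R^-1 :> R)%R by rewrite invr_gt0.
    have [k hk] := density0_thin m0 h.
    by exists k.
  move=> eps eps0.
  have [|k _ hk] := h (Num.bound eps^-1) => //.
  exists k.+1%:R^-1%R; first by rewrite invr_gt0.
  move=> r rr; apply: le_trans (hk r rr) _; rewrite lee_fin ler_wpM2r//.
    by rewrite exprn_ge0//; case/andP: rr => /ltW.
  rewrite invf_ple ?posrE//; apply: le_trans (ltW (archi_boundP _)) _.
    by rewrite invr_ge0 ltW.
  by rewrite ler_nat.
apply: (@bigcapT_measurable _ T) => m; apply: (@bigcupT_measurable _ T) => k.
by apply: (cara_closed mhalf); exact: thin_closed.
Qed.

Lemma cara_lsc (f : 'rV[R]_n -> \bar R) (D : set 'rV[R]_n) :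
  lower_semicontinuous f -> measurable (D : set T) -> measurable_fun (D : set T) f.
Proof.
move=> /lower_semicontinuousP lf mD.
apply: (measurability _ (ErealGenOInfty.measurableE R)).
move=> /= _ [_ [a ->]] <-; apply: (@measurableI _ T) => //.
by rewrite preimage_itvoy; apply: (cara_open mhalf); exact: lf.
Qed.

End density_borel.

(** A positive function has zero integral only over a negligible set; the
    boundary is a Borel set and f is Borel, hence measurable for Hausdorff
    measure. *)
Lemma weighted_perimeter0_null n (f : 'rV[R]_n.+1 -> R) (M : set 'rV[R]_n.+1) :
  (forall x, 0 < f x)%R -> lower_semicontinuous (EFin \o f) -> leb_measurable M ->
  weighted_perimeter f M = 0 -> hausdorff_outer n (no_density M) = 0.
Proof.
move=> f0 lf mM; rewrite /weighted_perimeter essential_boundaryE// => int0.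
pose T := caratheodory_type (@hausdorff_outer R n n.+1).
have mhalf := @hausdorff_halfspace R n n.+1.
have mB : measurable (no_density M : set T).
  by apply: (@measurableC _ T); apply: (@measurableU _ T); exact: cara_density0.
have mf := cara_lsc mhalf lf mB.
have : \int[hausdorff n n.+1]_(x in no_density M) `|(EFin \o f) x| = 0.
  by rewrite -[RHS]int0; apply: eq_integral => x _; rewrite /= ger0_norm// ltW.
move=> /(ae_eq_integral_abs _ mB mf) ae.
change (hausdorff n n.+1 (no_density M) = 0).
apply: (@measure_negligible _ T R (hausdorff n n.+1) _ mB).
apply: negligibleS ae => x Bx /= /(_ Bx) [] fx.
by have := f0 x; rewrite fx ltxx.
Qed.

Lemma weighted_perimeter0_trivial n (f : 'rV[R]_n.+1 -> R) (M : set 'rV[R]_n.+1) :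
  (forall x, 0 < f x)%R -> lower_semicontinuous (EFin \o f) -> leb_measurable M ->
  weighted_perimeter f M = 0 -> leb_outer M = 0 \/ leb_outer (~` M) = 0.
Proof.
move=> f0 lf mM P0; apply: null_boundary_trivial => i; apply: projection_null.
exact: weighted_perimeter0_null P0.
Qed.

End balls.

(** * Boxes have finite perimeter *)

Section box_perimeter.
Context {R : realType} {n : nat}.
Local Open Scope ereal_scope.
Local Notation T := (caratheodory_type (@leb_outer R n)).

Lemma leb_box_measurable (ab : 'rV[R]_n * 'rV[R]_n) : leb_measurable (box ab).
Proof. exact: cara_box (@leb_halfspace R n) ab. Qed.

(** Caratheodory's condition is invariant under translations, as the outer measure
    is. *)
Lemma leb_translate_measurable (v : 'rV[R]_n) (A : set 'rV[R]_n) :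
  leb_measurable A -> leb_measurable ((fun x => x + v)%R @^-1` A).
Proof.
move=> mA; change ((@leb_outer R n).-caratheodory ((fun x => x + v)%R @^-1` A)) => X.
have E (Y : set 'rV[R]_n) : [set (x + v)%R | x in X `&` (fun x => x + v)%R @^-1` Y] =
    [set (x + v)%R | x in X] `&` Y.
  apply/seteqP; split=> [_ [x [Xx Yx] <-]|_ [[x Xx <-] Yx]]; first by split=> //; exists x.
  by exists x.
rewrite -(leb_outer_translate v X) [LHS]mA -!E preimage_setC.
by congr (_ + _); exact: leb_outer_translate.
Qed.

Lemma leb_continuous_measurable (h : 'rV[R]_n -> R) (D : set 'rV[R]_n) :
  continuous h -> leb_measurable D -> measurable_fun (D : set T) (EFin \o h).
Proof.
move=> ch mD; apply: (cara_lsc (@leb_halfspace R n)) => //.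
apply/lower_semicontinuousP => a.
have -> : [set x | a%:E < (EFin \o h) x] = h @^-1` [set y | (a < y)%R].
  by apply/seteqP; split=> x /=; rewrite lte_fin.
by apply: open_comp => //; exact: open_gt.
Qed.

Lemma integral_translate (u : 'rV[R]_n -> R) (v : 'rV[R]_n) (D : set 'rV[R]_n) :
  continuous u -> (forall x, 0 <= u x)%R -> leb_measurable D ->
  \int[leb n]_(x in D) (u (x + v)%R)%:E =
  \int[leb n]_(x in (fun x => x - v)%R @^-1` D) (u x)%:E.
Proof.
move=> cu u0 mD.
have mphi : measurable_fun [set: T] ((fun x => x + v)%R : T -> T).
  by move=> _ A mA; rewrite setTI; exact: leb_translate_measurable.
have mD' : leb_measurable ((fun x => x - v)%R @^-1` D).
  exact: leb_translate_measurable.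
transitivity (\int[pushforward (leb n) ((fun x => x + v)%R : T -> T)]_(x in
    (fun x => x - v)%R @^-1` D) (u x)%:E); last first.
  apply: eq_measure_integral => A mA _; rewrite /pushforward.
  rewrite -[RHS](leb_outer_translate (- v)); congr (leb_outer _).
  apply/seteqP; split=> [x Ax|_ [x Ax <-]] /=; last by rewrite subrK.
  by exists (x + v)%R => //; rewrite addrK.
rewrite (ge0_integral_pushforward mphi)//.
- congr (integral _ _ _); apply/seteqP; split=> x /=; by rewrite addrK.
- exact: leb_continuous_measurable.
- by move=> x _; rewrite lee_fin.
Qed.

Variables (ab : 'rV[R]_n * 'rV[R]_n) (i : 'I_n).

Definition face_area : R :=
  (\prod_(j < n | j != i) Num.max 0 (ab.2 ord0 j - ab.1 ord0 j))%R.

Local Notation e := (delta_mx ord0 i : 'rV[R]_n).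

(** What the box sweeps beyond its upper face under the translation by h along
    the i-th axis. *)
Definition slab (h : R) : set 'rV[R]_n := box
  (setcoord ab.1 i (ab.2 ord0 i), setcoord ab.2 i (ab.2 ord0 i + h)%R).

Lemma leb_slab h : (0 <= h)%R -> leb_outer (slab h) = (h * face_area)%:E.
Proof.
move=> h0; rewrite leb_outer_box /box_vol; congr EFin.
rewrite (bigD1 i)//= !setcoordE eqxx addrC addKr max_r//; congr (_ * _)%R.
by apply: eq_bigr => j ji; rewrite !setcoordE (negPf ji).
Qed.

(** The translate of the box is contained in the union of the box and the slab. *)
Lemma integral_shift_le (u : 'rV[R]_n -> R) (h : R) :
  continuous u -> (forall x, 0 <= u x <= 2)%R -> (0 <= h)%R ->
  \int[leb n]_(x in box ab) (u (x + h *: e)%R)%:E <=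
  \int[leb n]_(x in box ab) (u x)%:E + (2 * (h * face_area))%:E.
Proof.
move=> cu u02 h0; have u0 x : (0 <= u x)%R by have /andP[] := u02 x.
have mQ := leb_box_measurable ab.
have mS : leb_measurable (slab h) by exact: leb_box_measurable.
have mu_ D : leb_measurable D -> measurable_fun (D : set T) (EFin \o u).
  exact: leb_continuous_measurable.
rewrite integral_translate//.
apply: (@le_trans _ _ (\int[leb n]_(x in box ab `|` slab h) (u x)%:E)).
  apply: ge0_subset_integral.
  - exact: leb_translate_measurable.
  - exact: (@measurableU _ T).
  - by apply: mu_; exact: (@measurableU _ T).
  - by move=> x _; rewrite lee_fin.
  move=> x bx; have xE j : x ord0 j = ((x - h *: e) ord0 j + h * (j == i)%:R)%R.
    by rewrite !mxE eqxx [in RHS]eq_sym subrK.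
  have [xi|xi] := leP (x ord0 i) (ab.2 ord0 i); [left|right] => j;
    have /= := bx j; have := xE j; have [->|ji] := eqVneq j i.
  - rewrite mulr1 xi => -> /andP[h1 h2]; apply/andP; split; lra.
  - by rewrite mulr0 addr0 => ->.
  - rewrite /= !setcoordE eqxx xi => xE' /andP[h1 h2]; rewrite xE' mulr1 /=; lra.
  - by rewrite /= !setcoordE (negPf ji) mulr0 addr0 => ->.
apply: (@le_trans _ _ (\int[leb n]_(x in box ab) (u x)%:E + \int[leb n]_(x in slab h) (u x)%:E)).
  rewrite ge0_integral_setU//.
  - by apply: mu_; exact: (@measurableU _ T).
  - by move=> x _; rewrite lee_fin.
  apply/disj_setPRL => x bx sx; have := bx i; have := sx i; rewrite /= !setcoordE eqxx.
  by move=> /andP[_ h2] /andP[h1 _]; move: h1; rewrite ltNge h2.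
apply: leeD2l.
apply: (@le_trans _ _ (\int[leb n]_(x in slab h) (cst 2%:E) x)).
  apply: ge0_le_integral => //.
  - by move=> x _; rewrite lee_fin.
  - exact: mu_.
  - by move=> x _; rewrite lee_fin; have /andP[] := u02 x.
rewrite integral_cst// EFinM; apply: lee_wpmul2l => //.
by rewrite -leb_slab.
Qed.

Lemma continuous_bounded_box (h : 'rV[R]_n -> R) (ab' : 'rV[R]_n * 'rV[R]_n) :
  continuous h -> exists K : R, (0 < K)%R /\ forall x : 'rV[R]_n,
    (forall j, ab'.1 ord0 j <= x ord0 j <= ab'.2 ord0 j)%R -> (`|h x| <= K)%R.
Proof.
move=> ch.
pose C := [set x : 'rV[R]_n | forall j, `[ab'.1 ord0 j, ab'.2 ord0 j]%classic (x ord0 j)].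
have cC : compact C.
  apply: (@rV_compact R n (fun j => `[ab'.1 ord0 j, ab'.2 ord0 j]%classic)) => j.
  exact: segment_compact.
have /compact_bounded[M [_ hM]] := continuous_compact (continuous_subspaceT ch) cC.
exists (`|M| + 1)%R; split; first by rewrite ltr_wpDl.
move=> x Cx; apply: (hM (`|M| + 1)%R); first by rewrite (le_lt_trans (ler_norm _))// ltrDl.
by exists x => // j; rewrite /= in_itv.
Qed.

End box_perimeter.

Section divergence_box.
Context {R : realType} {n : nat}.
Local Open Scope ereal_scope.
Local Notation T := (caratheodory_type (@leb_outer R n)).
Variables (ab : 'rV[R]_n * 'rV[R]_n) (i : 'I_n).
Local Notation e := (delta_mx ord0 i : 'rV[R]_n).

Lemma shift_continuous (v : 'rV[R]_n) : continuous (fun x : 'rV[R]_n => x + v)%R.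
Proof.
move=> x V /nbhs_ballP[d /= d0 hd]; apply/nbhs_ballP; exists d => // y xy.
apply: hd; move: xy; rewrite /= -!ball_normE /= opprD addrACA subrr addr0//.
Qed.

(** The bound that the divergence theorem would give, without Fubini: the integral
    of a difference quotient of step h is 1 / h times the difference of the
    integrals of psi over the box and over its translate, which is controlled by
    [integral_shift_le]; dominated convergence passes to the limit. *)
Lemma box_integral_derive_le (psi dpsi : 'rV[R]_n -> R) :
  continuous psi -> continuous dpsi ->
  (forall x, is_derive x e psi (dpsi x)) -> (forall x, `|psi x| <= 1)%R ->
  (leb n).-integrable (box ab : set T) (EFin \o dpsi) /\
  \int[leb n]_(x in box ab) (dpsi x)%:E <= (2 * face_area ab i)%:E.
Proof.
move=> cpsi cdpsi dp psi1.
have mQ := leb_box_measurable ab.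
have [K [K0 hK]] := continuous_bounded_box (ab.1, ab.2 + e)%R cdpsi.
pose h m : R := m.+1%:R^-1%R.
have h0 m : (0 < h m)%R by rewrite invr_gt0.
have h1 m : (h m <= 1)%R by rewrite invf_le1// ler1n.
pose q m (x : 'rV[R]_n) : R := ((h m)^-1 * (psi (x + h m *: e) - psi x))%R.
have cshift m : continuous (fun x : 'rV[R]_n => psi (x + h m *: e)%R).
  move=> x; apply: continuous_comp; last exact: cpsi.
  exact: shift_continuous.
have mq m : measurable_fun (box ab : set T) (EFin \o q m).
  apply: leb_continuous_measurable => // x.
  apply: (@cvgM _ _ (nbhs x)); first exact: cvg_cst.
  by apply: (@cvgB _ _ _ (nbhs x)); [exact: cshift|exact: cpsi].
have Qfin : leb n (box ab) < +oo by rewrite -[leb n _]/(leb_outer _) leb_outer_box ltry.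
have ibnd (u : 'rV[R]_n -> R) (c : R) : measurable_fun (box ab : set T) (EFin \o u) ->
    (forall x, box ab x -> `|u x| <= c)%R -> (leb n).-integrable (box ab : set T) (EFin \o u).
  move=> /measurable_EFinP mu_ uc; apply: measurable_bounded_integrable => //.
  exists c; split; first exact: num_real.
  by move=> y cy x bx; apply: le_trans (uc x bx) (ltW cy).
(* Domination, by the mean value theorem on the segment from x to x + h m e. *)
have qK m x : box ab x -> (`|q m x| <= K)%R.
  move=> bx.
  pose g s := psi (s *: e + x)%R.
  have dg (s : R) : is_derive s (1%R : R) g (dpsi (s *: e + x)%R).
    have [dv dvE] := dp (s *: e + x)%R.
    have E : (fun h : R => h^-1 *: ((g \o shift s) (h *: (1 : R)) - g s))%R =
             (fun h : R => h^-1 *: ((psi \o shift (s *: e + x)) (h *: e) - psi (s *: e + x)))%R.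
      by apply/funext => t; rewrite /g /= scaler1 scalerDl addrA.
    by apply: DeriveDef; [rewrite /derivable E|rewrite -dvE /derive E].
  have cg : {within `[0%R, h m], continuous g}.
    apply: continuous_subspaceT => s; apply: continuous_comp; last exact: cpsi.
    by apply: (@cvgD _ _ _ (nbhs s)); [exact: scalel_continuous|exact: cvg_cst].
  have [c cI] := @MVT_segment R g (fun s => dpsi (s *: e + x)%R) 0%R (h m)
    (ltW (h0 m)) (fun s _ => dg s) cg.
  rewrite /g scale0r add0r subr0 => E.
  rewrite /q [(x + _)%R]addrC E mulrCA mulVf ?mulr1 ?gt_eqF//.
  apply: hK => j /=; rewrite !mxE eqxx -/(e) eq_sym.
  have := bx j; move: cI; rewrite in_itv/= => /andP[c0 c1] /andP[b1 b2].
  have := h1 m; case: (i == j) => ?;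
    rewrite /= ?mulr1n ?mulr0n ?mulr1 ?mulr0; apply/andP; split; lra.
have qcvg x : (q m x)%:E @[m --> \oo] --> (dpsi x)%:E.
  have [dv dvE] := dp x.
  apply: cvg_EFin; first exact: nearW.
  have hm0 : h m @[m --> \oo] --> 0%R^'.
    move=> A A0.
    have H : \forall m \near \oo, h m != 0%R -> A (h m).
      exact: (@cvg_harmonic R _ (A0 : nbhs 0%R (fun y => y != 0%R -> A y))).
    change (\forall m \near \oo, A (h m)).
    by apply: filterS H => m; apply; rewrite gt_eqF.
  pose F (t : R) : R := (t^-1 *: (psi (t *: e + x) - psi x))%R.
  have Fcv : F t @[t --> 0%R^'] --> dpsi x by rewrite -dvE; exact: dv.
  rewrite (_ : fine \o _ = F \o h); last first.
    by apply/funext => m; rewrite /= /q /F [(x + _)%R]addrC.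
  exact: (@cvg_comp _ _ _ h F \oo (0%R^') (nbhs (dpsi x)) hm0 Fcv).
have mdp := leb_continuous_measurable cdpsi mQ.
have idp : (leb n).-integrable (box ab : set T) (EFin \o dpsi).
  apply: (ibnd _ K mdp) => x bx; apply: hK => j; rewrite /= mxE.
  have /andP[/ltW -> h2] := bx j; apply: le_trans h2 _.
  by rewrite lerDl mxE ler0n.
split=> //.
have cv : \int[leb n]_(x in box ab) (q m x)%:E @[m --> \oo] -->
    \int[leb n]_(x in box ab) (dpsi x)%:E.
  apply: (@dominated_cvg _ T R (leb n) (box ab) mQ
    (fun m => EFin \o q m) (EFin \o dpsi) (EFin \o cst K)) => //.
  - by move=> x _; exact: qcvg.
  - apply: (ibnd _ K) => [|x _]; first exact: (measurable_cst K%:E).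
    by rewrite /= gtr0_norm.
apply: (cvge_to_le cv); apply: nearW => m.
(* Shifting by a constant makes the integrand nonnegative without changing the
   difference quotients. *)
pose u (x : 'rV[R]_n) := (psi x + 1)%R.
have u02 x : (0 <= u x <= 2)%R.
  by have := psi1 x; rewrite ler_norml /u => /andP[? ?]; apply/andP; split; lra.
have cu : continuous u by move=> x; apply: (@cvgD _ _ _ (nbhs x)); [exact: cpsi|exact: cvg_cst].
have ush := integral_shift_le ab i cu u02 (ltW (h0 m)).
have iu : (leb n).-integrable (box ab : set T) (EFin \o u).
  apply: (ibnd _ 2%R) => [|x _]; first exact: leb_continuous_measurable.
  by have /andP[? ?] := u02 x; rewrite ger0_norm.
have ius : (leb n).-integrable (box ab : set T) (EFin \o (fun x : 'rV[R]_n => u (x + h m *: e)%R)).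
  apply: (ibnd _ 2%R) => [|x _].
    apply: leb_continuous_measurable => // x.
    by apply: (@cvgD _ _ _ (nbhs x)); [exact: cshift|exact: cvg_cst].
  by have /andP[? ?] := u02 (x + h m *: e)%R; rewrite ger0_norm.
have -> : \int[leb n]_(x in box ab) (q m x)%:E =
    (h m)^-1%:E * \int[leb n]_(x in box ab) ((u (x + h m *: e)%R)%:E - (u x)%:E).
  rewrite -integralZl//; last exact: integrableB.
  apply: eq_integral => x _; rewrite -EFinB -EFinM; congr EFin.
  by rewrite /q /u; congr (_ * _)%R; ring.
rewrite (integralB_EFin mQ ius iu).
have iufin := integrable_fin_num mQ iu.
rewrite muleC lee_pdivrMr// leeBlDr// addeC.
by apply: le_trans ush _; rewrite -EFinM -mulrA [(face_area _ _ * h m)%R]mulrC.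
Qed.

End divergence_box.

Section box_finite_perimeter.
Context {R : realType} {n : nat}.
Local Open Scope ereal_scope.
Local Notation T := (caratheodory_type (@leb_outer R n)).

(** The divergence is a sum of partial derivatives of components, each of absolute
    value at most one. *)
Lemma box_perimeter_in (ab : 'rV[R]_n * 'rV[R]_n) (Omega : set 'rV[R]_n) :
  perimeter_in Omega (box ab) <= (\sum_(i < n) 2 * face_area ab i)%:E.
Proof.
apply: ge_ereal_sup => _ [phi [dphi cJ _ _ phi1] <-].
pose psi i (x : 'rV[R]_n) : R := phi x ord0 i.
pose dpsi i (x : 'rV[R]_n) : R := jacobian phi x i i.
have H i : (leb n).-integrable (box ab : set T) (EFin \o dpsi i) /\
    \int[leb n]_(x in box ab) (dpsi i x)%:E <= (2 * face_area ab i)%:E.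
  apply: box_integral_derive_le.
  - move=> x; apply: (@continuous_comp _ _ _ phi (fun y : 'rV[R]_n => y ord0 i)).
      exact: differentiable_continuous.
    exact: coord_continuous.
  - move=> x; apply: (@continuous_comp _ _ _ (jacobian phi) (fun y : 'M[R]_n => y i i)).
      exact: cJ.
    exact: coord_continuous.
  - move=> x; have dv := diff_derivable (v := delta_mx ord0 i) (dphi x).
    apply: DeriveDef; first by have /derivable_mxP/(_ ord0 i) := dv.
    have := deriveEjacobian (delta_mx ord0 i) (dphi x).
    rewrite (derive_mx dv) -rowE => /matrixP/(_ ord0 i); rewrite [LHS]mxE [RHS]mxE; exact.
  - by move=> x; apply: le_trans (phi1 x); exact: coord_le_enorm.
have -> : \int[leb n]_(x in box ab) (divergence phi x)%:E =
    \int[leb n]_(x in box ab) (\sum_(i < n) (dpsi i x)%:E).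
  by apply: eq_integral => x _; rewrite sumEFin.
rewrite (integral_sum (f := fun i => EFin \o dpsi i) (leb_box_measurable ab) (fun i => (H i).1)).
by rewrite -sumEFin; apply: lee_sum => i _; exact: (H i).2.
Qed.

Lemma box_locally_finite_perimeter (ab : 'rV[R]_n * 'rV[R]_n) :
  locally_finite_perimeter (box ab).
Proof.
split=> [|Omega _ _]; first exact: leb_box_measurable.
by apply: le_lt_trans (box_perimeter_in _ _) _; rewrite ltry.
Qed.

End box_finite_perimeter.

(** * Hausdorff measure of the boundary of a cube *)
Section faces.
Context {R : realType}.
Local Open Scope ereal_scope.

Lemma hausdorff_preU k n delta (A B : set 'rV[R]_n) :
  hausdorff_pre k delta (A `|` B) <= hausdorff_pre k delta A + hausdorff_pre k delta B.
Proof.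
have w0 := @hausdorff_weight_ge0 R k n delta.
have := cover_outer_sigma_subadditive (fun A : small_set n delta => sval A) w0 (bigcup2 A B).
rewrite bigcup2E => /le_trans; apply.
apply: nneseries_le_bound => [j|K]; first exact: cover_outer_ge0.
have P0 := cover_outer0 (fun A : small_set n delta => sval A) w0.
case: K => [|[|K]].
- by rewrite big_ord0 adde_ge0// hausdorff_pre_ge0.
- by rewrite big_ord_recl big_ord0 adde0 leeDl// hausdorff_pre_ge0.
- by rewrite 2!big_ord_recl big1 ?adde0.
Qed.

(** Compares Hausdorff measure with volume on the faces: (n + 1) eta bounds the
    diameter of a fat box with sides at most eta, and (eta / 2)^n bounds its volume
    from below. *)
Definition face_const n : R := (@unit_ball_vol R n * n.+1%:R ^+ n)%R.

Lemma face_const_gt0 n : (0 < face_const n)%R.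
Proof. by rewrite mulr_gt0 ?unit_ball_vol_gt0 ?exprn_gt0. Qed.

Lemma hausdorff_pre_fat_box n (i : 'I_n.+1) (c delta eta : R) (ab : 'rV[R]_n * 'rV[R]_n) :
  (0 < eta)%R -> (n.+1%:R * eta <= delta)%R ->
  (forall j, eta / 2 <= ab.2 ord0 j - ab.1 ord0 j <= eta)%R ->
  hausdorff_pre n delta (insert i c @` box ab) <= (face_const n)%:E * box_vol ab.
Proof.
move=> eta0 etad fat.
pose A := insert i c @` box ab.
have A0 : A !=set0.
  exists (insert i c ab.2), ab.2 => // j; rewrite lexx andbT.
  by have /andP[h _] := fat j; lra.
have diam : ediam A <= (n.+1%:R * eta)%:E.
  apply: ge_ereal_sup => _ [[_ _] [[x bx <-] [y by_ <-]] <-]; rewrite lee_fin.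
  apply: enorm_le; first exact: ltW.
  apply: (forall_lift (i := i)).
    by rewrite !mxE unlift_none subrr normr0 ltW.
  move=> k; rewrite !mxE !liftK.
  have := bx k; have := by_ k; have := fat k => /andP[? ?] /andP[? ?] /andP[? ?].
  by rewrite ler_norml; apply/andP; split; lra.
have Ad : A !=set0 /\ ediam A <= delta%:E.
  by split=> //; apply: le_trans diam _; rewrite lee_fin.
pose S : small_set n.+1 delta := exist _ A Ad.
apply: (le_trans (@cover_outer_single _ _ _ (fun A : small_set n.+1 delta => sval A)
   (@hausdorff_weight R n n.+1 delta) S (@hausdorff_weight_ge0 R n n.+1 delta))).
apply: (@le_trans _ _ ((face_const n)%:E * ((eta / 2) ^+ n)%:E)); last first.
  by apply: lee_wpmul2l; [rewrite lee_fin ltW// face_const_gt0|exact: fat_box_vol].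
rewrite /hausdorff_weight -EFinM lee_fin /= /face_const -mulrA -exprMn.
apply: ler_wpM2l; first by rewrite ltW// unit_ball_vol_gt0.
have D0 : (0 <= fine (ediam A))%R by apply: fine_ge0; exact: ediam_ge0.
apply: lerXn2r; rewrite ?nnegrE ?divr_ge0 ?mulr_ge0 ?divr_ge0 ?(ltW eta0)//.
rewrite mulrA ler_pM2r//.
rewrite -lee_fin fineK// ge0_fin_numE; last exact: ediam_ge0.
by apply: le_lt_trans diam _; rewrite ltry.
Qed.

(** [fat_boxes] for the pre-measure at scale delta: a small fat box, seen in the
    hyperplane, is itself a competitor for the covers. *)
Lemma hausdorff_face_box n (i : 'I_n.+1) c (ab : 'rV[R]_n * 'rV[R]_n) :
  hausdorff_outer n (insert i c @` box ab) <= (face_const n)%:E * box_vol ab.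
Proof.
apply: ge_ereal_sup => _ [delta /= delta0 <-].
apply: (@fat_boxes R n (fun A => hausdorff_pre n delta (insert i c @` A)) _
  (ltW (face_const_gt0 n)) _ (delta / n.+1%:R)%R).
- by move=> A B; rewrite image_setU; exact: hausdorff_preU.
- by rewrite divr_gt0.
- rewrite image_set0 /hausdorff_pre cover_outer0//; exact: hausdorff_weight_ge0.
move=> eta cd /andP[eta0 etad] fat; apply: (hausdorff_pre_fat_box i c eta0) => //.
by rewrite mulrC -ler_pdivlMr// ltW.
Qed.

(** The corners of the half-open cube ]t, t + r]^n, with its lower corner on the
    diagonal. *)
Definition diag_cube n (t r : R) : 'rV[R]_n * 'rV[R]_n := (const_mx t, const_mx (t + r)%R).

Lemma diag_cube_vol n t r : (0 <= r)%R -> box_vol (diag_cube n t r) = (r ^+ n)%:E.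
Proof.
move=> r0; rewrite /box_vol; congr EFin.
rewrite (eq_bigr (fun=> r)) ?prodr_const ?card_ord// => i _.
by rewrite /= !mxE addrC addKr max_r.
Qed.

Definition diag_cube_boundary n (t r : R) : set 'rV[R]_n.+1 :=
  [set x | (forall j, t <= x ord0 j <= t + r)%R /\
           exists i, x ord0 i = t \/ x ord0 i = (t + r)%R].

(** A point off the topological boundary has a small cube around it which lies in
    the cube or in its complement. *)
Lemma no_density_diag_cube n t r :
  no_density (box (diag_cube n.+1 t r)) `<=` diag_cube_boundary t r.
Proof.
move=> x nd.
have in_ j : (t <= x ord0 j <= t + r)%R.
  apply/andP; split; rewrite leNgt; apply/negP => lt; apply: nd; left => eps eps0.
    exists (t - x ord0 j)%R; first by rewrite subr_gt0.
    move=> s /andP[s0 sd]; rewrite (_ : _ `&` _ = set0).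
      by rewrite (outer_measure0 (@leb_outer R n.+1)) lee_fin mulr_ge0 ?exprn_ge0// ltW.
    apply/seteqP; split=> // y [/(_ j) + /cubeP/(_ j)]; rewrite /= !mxE.
    by move=> /andP[? ?] /andP[? ?]; lra.
  exists (x ord0 j - (t + r))%R; first by rewrite subr_gt0.
  move=> s /andP[s0 sd]; rewrite (_ : _ `&` _ = set0).
    by rewrite (outer_measure0 (@leb_outer R n.+1)) lee_fin mulr_ge0 ?exprn_ge0// ltW.
  apply/seteqP; split=> // y [/(_ j) + /cubeP/(_ j)]; rewrite /= !mxE.
  by move=> /andP[? ?] /andP[? ?]; lra.
split=> //; apply: contrapT => /forallNP ne; apply: nd; right => eps eps0.
have st j : (t < x ord0 j < t + r)%R.
  have /not_orP[/eqP h1 /eqP h2] := ne j; have /andP[h3 h4] := in_ j.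
  by rewrite !lt_neqAle h3 h4 h2 eq_sym h1.
exists (\big[Num.min/1%R]_(j < n.+1) Num.min (x ord0 j - t) (t + r - x ord0 j))%R.
  elim/big_ind: _ => // [u v u0 v0|j _]; first by rewrite lt_min u0.
  by rewrite lt_min !subr_gt0.
move=> s /andP[s0 sd]; rewrite (_ : _ `&` _ = set0).
  by rewrite (outer_measure0 (@leb_outer R n.+1)) lee_fin mulr_ge0 ?exprn_ge0// ltW.
apply/seteqP; split=> // y [nby /cubeP cy]; apply: nby => j; rewrite /= !mxE.
have := lt_le_trans sd (bigmin_le _ j _); rewrite lt_min => /andP[h1 h2].
have /andP[h3 h4] := cy j; apply/andP; split; lra.
Qed.

(** Each of the 2 (n + 1) closed faces lies in a half-open box of sides 2 r in its
    hyperplane. *)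
Lemma hausdorff_diag_cube_boundary n t r : (0 < r)%R ->
  hausdorff_outer n (@diag_cube_boundary n t r) <=
  (n.+1%:R * (2 * (face_const n * (2 * r) ^+ n)))%:E.
Proof.
move=> r0.
pose ab : 'rV[R]_n * 'rV[R]_n := diag_cube n (t - r) (2 * r).
have abvol : box_vol ab = ((2 * r) ^+ n)%:E by rewrite diag_cube_vol// mulr_ge0// ltW.
pose F (i : 'I_n.+1) : set 'rV[R]_n.+1 :=
  insert i t @` box ab `|` insert i (t + r)%R @` box ab.
have HF i : hausdorff_outer n (F i) <= (2 * (face_const n * (2 * r) ^+ n))%:E.
  apply: (le_trans (outer_measureU2 (@hausdorff_outer R n n.+1) _ _)).
  rewrite mulr_natl mulr2n EFinD EFinM -abvol.
  by apply: leeD; exact: hausdorff_face_box.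
pose G k := if insub k is Some i then F i else set0.
apply: (@le_trans _ _ (hausdorff_outer n (\big[setU/set0]_(k < n.+1) G k))).
  apply: hausdorff_mono => x [xin [i xi]]; rewrite -bigcup_mkord.
  exists i; rewrite ?ltn_ord//= /G valK.
  have bd : box ab (drop_coord i x).
    by move=> j; rewrite /= !mxE; have /andP[? ?] := xin (lift i j); apply/andP; split; lra.
  by case: xi => xi; [left|right]; exists (drop_coord i x) => //; rewrite -xi drop_coordK.
apply: (le_trans (outer_measure_subadditive (@hausdorff_outer R n n.+1) _ _)).
apply: (@le_trans _ _ (\sum_(k < n.+1) (2 * (face_const n * (2 * r) ^+ n))%:E)).
  by apply: lee_sum => k _; rewrite /G valK; exact: HF.
by rewrite sumEFin lee_fin sumr_const card_ord [(n.+1%:R * _)%R]mulr_natl.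
Qed.

Lemma weighted_perimeter_diag_cube n (f : 'rV[R]_n.+1 -> R) (t r K : R) :
  (forall x, 0 < f x)%R -> lower_semicontinuous (EFin \o f) -> (0 < r)%R ->
  (forall x : 'rV[R]_n.+1, (forall j, t <= x ord0 j)%R -> f x <= K)%R ->
  weighted_perimeter f (box (diag_cube n.+1 t r)) <=
    (K * (n.+1%:R * (2 * (face_const n * (2 * r) ^+ n))))%:E.
Proof.
move=> f0 lf r0 fK; set M := box _.
have mM : leb_measurable M by exact: leb_box_measurable.
have K0 : (0 <= K)%R.
  by apply: le_trans (ltW (f0 (const_mx t))) _; apply: fK => j; rewrite mxE.
rewrite /weighted_perimeter essential_boundaryE//.
pose T := caratheodory_type (@hausdorff_outer R n n.+1).
have mhalf := @hausdorff_halfspace R n n.+1.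
have mB : measurable (no_density M : set T).
  by apply: (@measurableC _ T); apply: (@measurableU _ T); exact: cara_density0.
have mf := cara_lsc mhalf lf mB.
apply: (@le_trans _ _ (\int[hausdorff n n.+1]_(x in no_density M) (cst K%:E) x)).
  apply: ge0_le_integral => //.
  - by move=> x _; rewrite lee_fin ltW.
  - move=> x /no_density_diag_cube[xin _]; rewrite lee_fin; apply: fK => j.
    by have /andP[] := xin j.
rewrite integral_cst// EFinM; apply: lee_wpmul2l => //.
apply: le_trans (hausdorff_diag_cube_boundary n t r0).
by apply: hausdorff_mono; exact: no_density_diag_cube.
Qed.

End faces.

(** * Weighted volume of cubes *)

Section diag_cube_volume.
Context {R : realType} {n : nat}.
Local Open Scope ereal_scope.
Local Notation N := n.+1.
Local Notation T := (caratheodory_type (@leb_outer R N)).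
Variable g : 'rV[R]_N -> R.
Hypotheses (g_gt0 : forall x, (0 < g x)%R) (g_loc : locally_integrable_rV g).
Local Notation Q t r := (box (diag_cube N t r)).

Lemma diag_cubeP (t r : R) (x : 'rV[R]_N) :
  Q t r x <-> forall j, (t < x ord0 j <= t + r)%R.
Proof. by split=> h j; have := h j; rewrite /= !mxE. Qed.

Lemma diag_cube_sub (t r s : R) : (r <= s)%R -> Q t r `<=` Q t s.
Proof.
move=> rs x /diag_cubeP h; apply/diag_cubeP => j; have /andP[-> h2] := h j.
by apply: le_trans h2 _; rewrite lerD2l.
Qed.

Lemma integrable_diag_cube t r : (leb N).-integrable (Q t r : set T) (EFin \o g).
Proof.
pose C := [set x : 'rV[R]_N | forall j, `[t, (t + r)%R]%classic (x ord0 j)].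
have cC : compact C.
  by apply: (@rV_compact R N (fun j => `[t, (t + r)%R]%classic)) => j; exact: segment_compact.
have clC : closed C by apply: compact_closed cC; exact: norm_hausdorff.
apply: integrableS (g_loc cC).
- exact: (cara_closed (@leb_halfspace R N)).
- exact: leb_box_measurable.
- by move=> x /diag_cubeP xQ j; rewrite /= in_itv/=; have /andP[/ltW -> ->] := xQ j.
Qed.

(** Local integrability is about compact sets; exhaust the space by cubes. *)
Lemma measurable_weight (D : set 'rV[R]_N) : leb_measurable D ->
  measurable_fun (D : set T) (EFin \o g).
Proof.
move=> mD; apply: (@measurable_funS _ _ T _ [set: T] D (EFin \o g) (@measurableT _ T)
  (@subsetT _ D)).
have -> : [set: T] = \bigcup_k Q (- k%:R)%R (2 * k%:R)%R.
  apply/seteqP; split=> // x _; exists (Num.bound `|x|%R).+1 => //; apply/diag_cubeP => j.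
  have h1 := archi_boundP (normr_ge0 x).
  have h2 := coord_le_norm x j.
  by move: h2; rewrite ler_norml -natr1 => /andP[? ?]; apply/andP; split; lra.
apply/measurable_fun_bigcup => k; first exact: leb_box_measurable.
by have /integrableP[] := integrable_diag_cube (- k%:R)%R (2 * k%:R)%R.
Qed.

Lemma volume_ge t r c : (0 <= c)%R -> (0 <= r)%R -> (forall x, Q t r x -> c <= g x)%R ->
  (c * r ^+ N)%:E <= weighted_volume g (Q t r).
Proof.
move=> c0 r0 cg; have mQ : leb_measurable (Q t r) by exact: leb_box_measurable.
apply: (@le_trans _ _ (\int[leb N]_(x in Q t r) (cst c%:E) x)).
  by rewrite integral_cst// EFinM -(diag_cube_vol N t r0) -leb_outer_box.
apply: ge0_le_integral.
- exact: mQ.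
- by move=> x _; rewrite lee_fin.
- exact: measurable_cst.
- exact: measurable_weight.
- by move=> x Qx; rewrite lee_fin; exact: cg.
Qed.

Lemma volume_mono D D' : leb_measurable D -> leb_measurable D' -> D `<=` D' ->
  weighted_volume g D <= weighted_volume g D'.
Proof.
move=> mD mD' DD'; apply: ge0_subset_integral.
- exact: mD.
- exact: mD'.
- exact: measurable_weight.
- by move=> x _; rewrite lee_fin ltW.
- exact: DD'.
Qed.

Lemma volumeU D D' : leb_measurable D -> leb_measurable D' -> D `&` D' = set0 ->
  weighted_volume g (D `|` D') = weighted_volume g D + weighted_volume g D'.
Proof.
move=> mD mD' DD'; apply: ge0_integral_setU.
- exact: mD.
- exact: mD'.
- by apply: measurable_weight; exact: (@measurableU _ T).
- by move=> x _; rewrite lee_fin ltW.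
- by apply/disj_setPS; rewrite DD'.
Qed.

Lemma volume_ge0 D : 0 <= weighted_volume g D.
Proof. by apply: integral_ge0 => x _; rewrite lee_fin ltW. Qed.

Lemma leb_outer_diag_cube (t r : R) : leb_outer (Q t r) = ((Num.max 0 r) ^+ N)%:E.
Proof.
rewrite leb_outer_box /box_vol; congr EFin.
rewrite (eq_bigr (fun=> Num.max 0 r)%R) ?prodr_const ?card_ord// => i _.
by rewrite /= !mxE addrC addKr.
Qed.

(** Intermediate value theorem for the volume as a function of the side r, which is
    continuous by absolute continuity of the integral. *)
Lemma volume_attains t r0 d : (0 < d)%R -> (0 <= r0)%R ->
  d%:E <= weighted_volume g (Q t r0) ->
  exists2 r, (0 < r <= r0)%R & weighted_volume g (Q t r) = d%:E.
Proof.
move=> d0 r00 dv.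
have mQ r : leb_measurable (Q t r) by exact: leb_box_measurable.
have mQD r s : leb_measurable (Q t r `\` Q t s) by exact: (@measurableD _ T _ _ (mQ r) (mQ s)).
(* Truncated, so that the integral is finite for every r. *)
pose f : 'rV[R]_N -> R := g \_ (Q t r0).
have intf : (leb N).-integrable [set: T] (EFin \o f).
  rewrite /f -restrict_EFin.
  have mQ0 : measurable (Q t r0 : set T) := mQ r0.
  apply/(integrable_restrict (leb N) mQ0 (@measurableT _ T)).
  by rewrite setTI; exact: integrable_diag_cube.
have f0 x : (0 <= f x)%R by rewrite /f /patch; case: ifP => // _; exact: ltW.
have mf D : leb_measurable D -> measurable_fun (D : set T) (EFin \o f).
  move=> mD; have /integrableP[m _] := intf.
  exact: (@measurable_funS _ _ T _ [set: T] D _ (@measurableT _ T) (@subsetT _ D)).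
pose W r := fine (\int[leb N]_(x in Q t r) (f x)%:E).
have ffin D : leb_measurable D -> \int[leb N]_(x in D) (f x)%:E \is a fin_num.
  move=> mD; apply: integrable_fin_num; first exact: mD.
  by apply: (integrableS (@measurableT _ T) mD (@subsetT _ D) intf).
have WE r : (r <= r0)%R -> (W r)%:E = weighted_volume g (Q t r).
  move=> rr; rewrite fineK ?ffin//; apply: eq_integral => x; rewrite inE => Qx.
  by rewrite /f patchE mem_set//; exact: diag_cube_sub Qx.
have Wdiff r s : (r <= s)%R ->
    W s = (W r + fine (\int[leb N]_(x in Q t s `\` Q t r) (f x)%:E))%R.
  move=> rs; have mD := mQD s r.
  rewrite /W -(fineD (ffin _ (mQ r)) (ffin _ mD)).
  congr fine; rewrite -ge0_integral_setU.
  - by rewrite setDUK//; exact: diag_cube_sub.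
  - exact: mQ.
  - exact: mQD.
  - by apply: mf; apply: (@measurableU _ T); [exact: mQ|exact: mQD].
  - by move=> x _; rewrite lee_fin.
  - by apply/disj_setPS => x [Qx [_]].
have Wnd r s : (r <= s)%R -> (W r <= W s)%R.
  move=> rs; rewrite (Wdiff r s rs) lerDl fine_ge0// integral_ge0// => x _.
  by rewrite lee_fin.
pose p (r : R) := ((Num.max 0 r) ^+ N)%R.
have cp : continuous p.
  move=> r; apply: (@continuous_comp _ _ _ (fun r : R => Num.max 0 r)%R (fun s => s ^+ N)%R).
    by apply: continuous_max; [exact: cvg_cst|exact: cvg_id].
  exact: exprn_continuous.
have lebD r s : (r <= s)%R -> leb N (Q t s `\` Q t r) = (p s - p r)%:E.
  move=> rs; rewrite measureD; [|exact: mQ|exact: mQ|]; last first.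
    suff : leb_outer (Q t s) < +oo by [].
    by rewrite leb_outer_diag_cube ltry.
  rewrite (_ : Q t s `&` Q t r = Q t r); last by apply/setIidPr; exact: diag_cube_sub.
  rewrite EFinB.
  exact: (congr2 (fun u v : \bar R => u - v) (leb_outer_diag_cube t s) (leb_outer_diag_cube t r)).
have cW : continuous W.
  move=> r; apply/cvgrPdist_lt => e e0.
  have [dl [dl0 hdl]] := integral_normr_continuous intf e0.
  have key u v : (u <= v)%R -> (p v - p u < dl)%R -> (`|W u - W v| < e)%R.
    move=> uv puv; rewrite ler0_norm ?subr_le0 ?Wnd// opprB (Wdiff u v uv) addrC addKr.
    have := hdl _ (mQD v u); rewrite lebD// lte_fin => /(_ puv); apply: le_lt_trans.
    rewrite /Rintegral le_eqVlt; apply/orP; left; apply/eqP; congr fine.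
    by apply: eq_integral => x _; rewrite ger0_norm.
  have /cvgrPdist_lt/(_ _ dl0) := cp r; apply: filterS => s ps.
  have [rs|sr] := leP r s.
    by apply: key => //; apply: le_lt_trans ps; rewrite distrC ler_norm.
  rewrite distrC; apply: key; first exact: ltW.
  by apply: le_lt_trans ps; rewrite ler_norm.
have W0 : W 0%R = 0%R.
  rewrite /W (_ : Q t 0%R = set0) ?integral_set0//.
  apply/seteqP; split=> // x /diag_cubeP/(_ ord0); rewrite addr0 => /andP[h1 h2].
  by have := lt_le_trans h1 h2; rewrite ltxx.
have Wr0 : (d <= W r0)%R by rewrite -lee_fin WE.
have [||r rI Wr] := @IVT R W 0%R r0 d r00.
- exact: continuous_subspaceT.
- by rewrite W0 ge_min le_max (ltW d0) Wr0 orbT.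
move: rI; rewrite in_itv/= => /andP[rge rle].
exists r; last by rewrite -WE// Wr.
rewrite rle andbT lt_neqAle rge andbT; apply/eqP => r0E.
by move: Wr; rewrite -r0E W0 => dE; move: d0; rewrite -dE ltxx.
Qed.

End diag_cube_volume.

(** * Distant cubes of small weighted perimeter *)

Section decay.
Context {R : realType} {n : nat}.
Local Notation N := n.+1.
Local Notation Q t r := (box (diag_cube N t r)).

Lemma enorm_ge_coords t (x : 'rV[R]_N) : (forall j, t <= x ord0 j) -> t <= enorm x.
Proof.
move=> h; apply: le_trans (h ord0) _; apply: le_trans (ler_norm _) _.
exact: coord_le_enorm.
Qed.

Lemma powRN_anti (x y a : R) : 0 < x -> x <= y -> 0 <= a ->
  y `^ (- a) <= x `^ (- a).
Proof.
move=> x0 xy a0; have y0 := lt_le_trans x0 xy.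
rewrite !powRN lef_pV2 ?posrE ?powR_gt0//.
by apply: ge0_ler_powR; rewrite ?nnegrE // ltW.
Qed.

Variables (f g : 'rV[R]_N -> R) (alpha beta R1 c1 c2 d : R).
Hypotheses (f_gt0 : forall x, 0 < f x) (g_gt0 : forall x, 0 < g x).
Hypotheses (g_loc : locally_integrable_rV g) (f_lsc : lower_semicontinuous (EFin \o f)).
Hypotheses (alpha_gt0 : 0 < alpha) (beta_gt0 : 0 < beta).
Hypotheses (R1_gt0 : 0 < R1) (c1_gt0 : 0 < c1) (c2_gt0 : 0 < c2).
Hypothesis f_le : forall x, R1 <= enorm x -> f x <= c1 * enorm x `^ (- alpha).
Hypothesis g_ge : forall x, R1 <= enorm x -> c2 * enorm x `^ (- beta) <= g x.
Hypothesis beta_le : beta <= N%:R.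
Hypothesis alpha_gt : n%:R / N%:R * beta < alpha.
Hypothesis d_gt0 : 0 < d.

Lemma weight_ge_diag_cube t r x : R1 <= t -> 0 <= r -> Q t r x ->
  c2 * (N%:R * (t + r)) `^ (- beta) <= g x.
Proof.
move=> Rt r0 /diag_cubeP xQ; have t0 := lt_le_trans R1_gt0 Rt.
have tx : t <= enorm x.
  by apply: enorm_ge_coords => j; have /andP[/ltW] := xQ j.
apply: le_trans (g_ge (le_trans Rt tx)); rewrite ler_pM2l//.
apply: powRN_anti; [exact: lt_le_trans tx| |exact: ltW].
apply: enorm_le; first by rewrite addr_ge0// ltW.
move=> j; have /andP[h1 h2] := xQ j.
by rewrite gtr0_norm// (lt_trans t0).
Qed.

(** A lower bound, independent of s, for the mass of ]s, 2 s]^N. *)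
Definition dyadic_mass : R := c2 * (N%:R * 2) `^ (- beta).

Lemma dyadic_mass_gt0 : 0 < dyadic_mass.
Proof. by rewrite mulr_gt0// powR_gt0// mulr_gt0. Qed.

(** The mass is at least of order s^(- beta) s^N, a nonnegative power of s because
    beta <= N. *)
Lemma volume_doubling_cube s : R1 <= s -> 1 <= s ->
  (dyadic_mass%:E <= weighted_volume g (Q s s))%E.
Proof.
move=> Rs s1; have s0 : 0 < s := lt_le_trans ltr01 s1.
apply: le_trans (volume_ge g_loc (t := s) (r := s)
  (c := c2 * (N%:R * (s + s)) `^ (- beta)) _ (ltW s0) _); last 2 first.
- by rewrite mulr_ge0 ?powR_ge0 ?ltW.
- by move=> x; apply: weight_ge_diag_cube => //; exact: ltW.
rewrite lee_fin (_ : s + s = 2 * s); last by ring.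
rewrite mulrA [X in _ <= _ * X * _]powRM ?mulr_ge0 ?(ltW s0)// !mulrA -/dyadic_mass -mulrA.
rewrite ler_peMr ?(ltW dyadic_mass_gt0)// -powR_mulrn ?(ltW s0)// -powRD ?(gt_eqF s0)//.
  apply: (@le_trans _ _ (s `^ 0)); first by rewrite powRr0.
  by apply: ler_powR => //; rewrite addrC subr_ge0.
by rewrite implybT.
Qed.

(** ]t, 2^J t]^N contains the J disjoint cubes ]2^j t, 2^(j+1) t]^N. *)
Lemma volume_dyadic t J : R1 <= t -> 1 <= t ->
  ((J%:R * dyadic_mass)%:E <= weighted_volume g (Q t ((2 ^+ J - 1) * t)))%E.
Proof.
move=> Rt t1; have t0 : 0 < t := lt_le_trans ltr01 t1.
elim: J => [|J IH].
  by rewrite mul0r; exact: volume_ge0.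
pose s := 2 ^+ J * t.
have ts : t <= s by rewrite ler_peMl ?(ltW t0)// exprn_ege1// ler1n.
have mQ (a r : R) : leb_measurable (Q a r) by exact: leb_box_measurable.
have sE : t + (2 ^+ J - 1) * t = s by rewrite /s; ring.
have disj : Q t ((2 ^+ J - 1) * t) `&` Q s s = set0.
  apply/seteqP; split=> // x [/diag_cubeP/(_ ord0) /andP[_]].
  by rewrite sE => h1 /diag_cubeP/(_ ord0) /andP[h2 _]; have := lt_le_trans h2 h1; rewrite ltxx.
have sub : Q t ((2 ^+ J - 1) * t) `|` Q s s `<=` Q t ((2 ^+ J.+1 - 1) * t).
  have E : t + (2 ^+ J.+1 - 1) * t = s + s by rewrite /s exprS; ring.
  move=> x [] /diag_cubeP h; apply/diag_cubeP => j; rewrite E; have /andP[h1 h2] := h j.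
    rewrite h1 /=; move: h2; rewrite sE => h2; apply: le_trans h2 _.
    by rewrite lerDl (le_trans (ltW t0)).
  by rewrite h2 andbT (le_lt_trans ts).
have mU : leb_measurable (Q t ((2 ^+ J - 1) * t) `|` Q s s).
  by apply: (@measurableU _ (caratheodory_type (@leb_outer R N))); exact: mQ.
apply: (le_trans _ (volume_mono g_gt0 g_loc mU (mQ _ _) sub)).
rewrite volumeU// -natr1 mulrDl mul1r EFinD; apply: leeD => //.
by apply: volume_doubling_cube; exact: le_trans ts.
Qed.

Lemma volume_unbounded (v : R) :
  exists J, forall t, R1 <= t -> 1 <= t ->
    (v%:E <= weighted_volume g (Q t ((2 ^+ J - 1) * t)))%E.
Proof.
exists (Num.bound `|v / dyadic_mass|) => t Rt t1.
apply: le_trans (volume_dyadic _ Rt t1); rewrite lee_fin -ler_pdivrMr ?dyadic_mass_gt0//.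
exact: le_trans (ler_norm _) (ltW (archi_boundP (normr_ge0 _))).
Qed.

(** The mass d is at least a constant times t^(- beta) r^N, because the cube lies in
    the ball of radius N 2^J t; hence r^N is at most of order t^beta, and the power
    n / N of this inequality bounds r^n. *)
Lemma side_pow_le (J : nat) : exists2 B, 0 < B & forall t r, R1 <= t -> 0 <= r ->
  r <= (2 ^+ J - 1) * t -> weighted_volume g (Q t r) = d%:E ->
  r ^+ n <= B * t `^ (n%:R / N%:R * beta).
Proof.
pose A := d / c2 * (N%:R * 2 ^+ J) `^ beta.
have J0 : 0 < 2 ^+ J :> R by rewrite exprn_gt0.
have A0 : 0 < A by rewrite mulr_gt0 ?divr_gt0// powR_gt0// mulr_gt0.
exists (A `^ (n%:R / N%:R)); first exact: powR_gt0.
move=> t r Rt r0 rJ vE; have t0 : 0 < t := lt_le_trans R1_gt0 Rt.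
have rA : r ^+ N <= A * t `^ beta.
  have Nt0 : 0 < N%:R * (2 ^+ J * t) by rewrite !mulr_gt0.
  have := volume_ge g_loc (t := t) (r := r)
    (c := c2 * (N%:R * (2 ^+ J * t)) `^ (- beta)) _ r0 _.
  rewrite vE lee_fin => h.
  have {}h : c2 * (N%:R * (2 ^+ J * t)) `^ (- beta) * r ^+ N <= d.
    apply: h; first by rewrite mulr_ge0 ?powR_ge0 ?ltW.
    move=> x Qx; apply: le_trans (weight_ge_diag_cube Rt r0 Qx).
    rewrite ler_pM2l//; apply: powRN_anti; [|rewrite ler_pM2l//|exact: ltW].
      by rewrite mulr_gt0// ltr_wpDr.
    by move: rJ; lra.
  have E : A * t `^ beta = d / (c2 * (N%:R * (2 ^+ J * t)) `^ (- beta)).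
    rewrite powRN (mulrA N%:R) [X in _ = _ / (_ * X^-1)]powRM ?mulr_ge0 ?(ltW t0) ?(ltW J0)// /A.
    by field; rewrite !gt_eqF// powR_gt0// mulr_gt0.
  by rewrite E ler_pdivlMr ?mulr_gt0 ?powR_gt0// mulrC.
have E1 : r ^+ n = (r ^+ N) `^ (n%:R / N%:R).
  rewrite -!powR_mulrn// -powRrM; congr (_ `^ _).
  by rewrite mulrC divfK// gt_eqF.
have E2 : A `^ (n%:R / N%:R) * t `^ (n%:R / N%:R * beta) = (A * t `^ beta) `^ (n%:R / N%:R).
  by rewrite powRM ?powR_ge0 ?(ltW A0)// -powRrM (mulrC beta).
rewrite E1 E2; apply: ge0_ler_powR => //; rewrite nnegrE.
- exact: exprn_ge0.
- by rewrite mulr_ge0 ?powR_ge0// ltW.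
Qed.

(** The weighted perimeter is at most C t^(- gam) with
    gam = alpha - n / N beta > 0, and t is taken so large that this is at most e. *)
Lemma small_perimeter_diag_cube e : 0 < e -> exists t r,
  weighted_volume g (Q t r) = d%:E /\ (weighted_perimeter f (Q t r) <= e%:E)%E.
Proof.
move=> e0; have [J vJ] := volume_unbounded d; have [B B0 hB] := side_pow_le J.
have fc0 := @face_const_gt0 R n.
pose C := c1 * (N%:R * (2 * (face_const n * 2 ^+ n))) * B.
have C0 : 0 < C by rewrite /C; do ![apply: mulr_gt0 => //]; exact: exprn_gt0.
pose gam := alpha - n%:R / N%:R * beta.
have gam0 : 0 < gam by rewrite subr_gt0.
pose t := Num.max (Num.max R1 1) ((C / e) `^ gam^-1).
have Rt : R1 <= t by rewrite !le_max lexx.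
have t1 : 1 <= t by rewrite !le_max lexx orbT.
have t0 : 0 < t := lt_le_trans ltr01 t1.
have tC : C * t `^ (- gam) <= e.
  rewrite powRN ler_pdivrMr ?powR_gt0// mulrC -ler_pdivrMr//.
  have -> : C / e = ((C / e) `^ gam^-1) `^ gam.
    by rewrite -powRrM mulVf ?gt_eqF// powRr1// ltW// divr_gt0.
  apply: ge0_ler_powR; rewrite ?nnegrE ?powR_ge0 ?(ltW t0) ?(ltW gam0)//.
  by rewrite !le_max lexx orbT.
have J1 : 0 <= (2 ^+ J - 1) * t.
  by rewrite mulr_ge0 ?(ltW t0)// subr_ge0 exprn_ege1// ler1n.
have [r /andP[r0 rJ] vE] := volume_attains g_gt0 g_loc d_gt0 J1 (vJ t Rt t1).
exists t, r; split=> //.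
apply: le_trans (weighted_perimeter_diag_cube (K := c1 * t `^ (- alpha)) f_gt0 f_lsc r0 _) _.
  move=> x xt; have tx := enorm_ge_coords xt.
  apply: le_trans (f_le (le_trans Rt tx)) _; rewrite ler_pM2l//.
  by apply: powRN_anti => //; exact: ltW.
rewrite lee_fin; apply: le_trans tC.
have -> : t `^ (- gam) = t `^ (- alpha) * t `^ (n%:R / N%:R * beta).
  by rewrite -powRD ?(gt_eqF t0) ?implybT// /gam opprB addrC.
have := hB t r Rt (ltW r0) rJ vE.
have ta := powR_gt0 (- alpha) t0.
rewrite exprMn => hr; rewrite /C.
rewrite [leRHS](_ : _ = c1 * t `^ (- alpha) *
  (N%:R * (2 * (face_const n * (2 ^+ n * (B * t `^ (n%:R / N%:R * beta))))))); last by ring.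
by rewrite !ler_pM2l// ?exprn_gt0// mulr_gt0.
Qed.

(** A solution would have weighted perimeter zero, hence be null or have a null
    complement; its mass would be zero, or at least that of every cube, which can be
    made larger than d. *)
Lemma no_isoperimetric_solution M : ~ isoperimetric_solution f g d M.
Proof.
move=> [[[mM _] vM] pM].
have p0 : weighted_perimeter f M = 0%E.
  apply/eqP; rewrite eq_le; apply/andP; split; last first.
    by apply: integral_ge0 => x _; rewrite lee_fin ltW.
  apply/lee_addgt0Pr => e e0; rewrite add0e.
  have [t [r [vQ pQ]]] := small_perimeter_diag_cube e0.
  rewrite pM; apply: le_trans pQ; apply: ereal_inf_lbound.
  by exists (Q t r) => //; split=> //; exact: box_locally_finite_perimeter.
have null D : leb_measurable D -> leb_outer D = 0%E -> weighted_volume g D = 0%E.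
  move=> mD D0; apply: null_set_integral.
  - exact: mD.
  - exact: (measurable_weight g_loc).
  - exact: D0.
have [M0|Mc0] := weighted_perimeter0_trivial f_gt0 f_lsc mM p0.
  by move: vM; rewrite null// => -[dE]; move: d_gt0; rewrite -dE ltxx.
have mMc : leb_measurable (~` M) by exact: (@measurableC _ (caratheodory_type (@leb_outer R N))).
have [J vJ] := volume_unbounded (d + 1).
pose t := Num.max R1 1; have Rt : R1 <= t by rewrite le_max lexx.
have t1 : 1 <= t by rewrite le_max lexx orbT.
have mQ : leb_measurable (Q t ((2 ^+ J - 1) * t)) by exact: leb_box_measurable.
have mU : leb_measurable (M `|` ~` M).
  exact: (@measurableU _ (caratheodory_type (@leb_outer R N)) _ _ mM mMc).
have := le_trans (vJ t Rt t1) (volume_mono g_gt0 g_loc mQ mU _).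
rewrite volumeU ?setICr// vM null// adde0 lee_fin => h.
suff : d + 1 <= d by rewrite gerDl leNgt ltr01.
by apply: h; rewrite setUv; exact: subsetT.
Qed.

End decay.

Theorem theorem5p1 (R : realType) (N : nat) (hN : (2 <= N)%N)
    (f g : 'rV[R]_N -> R)
    (f_gt0 : forall x, 0 < f x) (g_gt0 : forall x, 0 < g x)
    (g_loc : locally_integrable_rV g)
    (f_lsc : lower_semicontinuous (EFin \o f))
    (alpha beta R1 c1 c2 : R)
    (alpha_gt0 : 0 < alpha) (beta_gt0 : 0 < beta) (R1_gt0 : 0 < R1)
    (c1_gt0 : 0 < c1) (c2_gt0 : 0 < c2)
    (f_le : forall x, R1 <= enorm x -> f x <= c1 * enorm x `^ (- alpha))
    (g_ge : forall x, R1 <= enorm x -> c2 * enorm x `^ (- beta) <= g x)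
    (beta_le : beta <= N%:R)
    (alpha_gt : (N%:R - 1) / N%:R * beta < alpha)
    (d : R) (d_gt0 : 0 < d) :
  ~ exists M : set 'rV[R]_N, isoperimetric_solution f g d M.
Proof.
case: N hN f g f_gt0 g_gt0 g_loc f_lsc f_le g_ge beta_le alpha_gt => // n _ f g
  f_gt0 g_gt0 g_loc f_lsc f_le g_ge beta_le.
rewrite -{1}natr1 addrK => alpha_gt [M].
exact: (no_isoperimetric_solution f_gt0 g_gt0 g_loc f_lsc alpha_gt0 beta_gt0
  R1_gt0 c1_gt0 c2_gt0 f_le g_ge beta_le alpha_gt d_gt0).
Qed.
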